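(* There exist absolute constants $C\ge 1$ and $c>0$ such that the following holds. Let $d,n\ge 1$, let $X,X_1,\ldots,X_n$ be i.i.d. real random variables, and let $a=(a_1,\ldots,a_n)$ with $a_k\in\mathbf{R}^d$. Suppose that for some $\alpha>0$, $$\sum_{k=1}^{n}(\langle t,a_k\rangle-m_k)^2\geq\alpha^2$$ for all $m_1,\ldots,m_n\in\mathbf{Z}$ and all $t\in\mathbf{R}^d$ such that $\max_k|\langle t,a_k\rangle|\geq 1/2$ and $\|t\|\leq\sqrt{d}$. Then $$Q(F_a,\sqrt{d})\le C^d\Big[\Big(\frac{1}{\sqrt{M(1)}}\Big)^d\frac{1}{\sqrt{\det\mathbb{N}}}+\exp\big(-c\,\alpha^2M(1)\big)\Big].$$
   Context: $F_a$ denotes the distribution of $S_a=\sum_{k=1}^n X_k a_k\in\mathbf{R}^d$. For a distribution $F=\mathcal{L}(Y)$ of a random vector $Y$ in $\mathbf{R}^d$, the concentration function is $Q(F,\lambda)=\sup_{x\in\mathbf{R}^d}\mathbf{P}(Y\in x+\lambda B)$, $\lambda\ge 0$, where $B=\{x\in\mathbf{R}^d:\|x\|\le 1\}$ and $\|\cdot\|$ is the Euclidean norm. Let $\widetilde X=X_1-X_2$ and for $\tau>0$ let $M(\tau)=\mathbf{E}\min\{\widetilde X^2/\tau^2,1\}$. The $d\times d$ matrix $\mathbb{N}=\sum_{k=1}^n a_k a_k^{T}$, i.e. $\mathbb{N}_{ij}=\sum_{k=1}^n a_{ki}a_{kj}$ where $a_k=(a_{k1},\ldots,a_{kd})$. If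 $\det\mathbb{N}=0$ or $M(1)=0$ the right-hand side is interpreted as $+\infty$. *)

(* Defs.v *)
From HB Require Import structures.
From mathcomp Require Import all_boot all_order all_algebra.
From mathcomp Require Import all_classical all_reals all_analysis.
From mathcomp Require Import Rstruct Rstruct_topology.
From Stdlib Require Import Reals.

Set Implicit Arguments.
Unset Strict Implicit.
Unset Printing Implicit Defensive.
Import Order.TTheory GRing.Theory Num.Theory.
Import numFieldNormedType.Exports.

Local Open Scope classical_set_scope.
Local Open Scope ring_scope.

Definition RR : realType := Rdefinitions.R.

Definition dotv (d : nat) (u v : 'rV[RR]_d) : RR := \sum_(i < d) u 0 i * v 0 i.
Definition enorm (d : nat) (u : 'rV[RR]_d) : RR := Num.sqrt (dotv u u).

Definition mutually_independent d0 (T : measurableType d0) (P : probability T RR)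
    (n : nat) (X : 'I_n -> {RV P >-> RR}) : Prop :=
  forall (J : {set 'I_n}) (B : 'I_n -> set RR),
    (forall j, j \in J -> measurable (B j)) ->
    P (\bigcap_(j in [set j | j \in J]) (X j @^-1` B j)) =
      (\prod_(j in J) P (X j @^-1` B j))%E.

Definition has_law d0 (T : measurableType d0) (P : probability T RR)
    (Y : {RV P >-> RR}) (mu : probability RR RR) : Prop :=
  forall A : set RR, measurable A -> distribution P Y A = mu A.

(* M(tau) = E min(Xtilde^2/tau^2, 1), Xtilde = X_1 - X_2 with X_1, X_2
   independent with law mu: the expectation under mu (x) mu, written as an
   iterated integral. *)
Definition Mfun (mu : probability RR RR) (tau : RR) : RR :=
  fine (\int[mu]_x \int[mu]_y (Order.min ((x - y) ^+ 2 / tau ^+ 2) 1)%:E)%E.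

Definition Ssum d0 (T : measurableType d0) (P : probability T RR) (n d : nat)
    (X : 'I_n -> {RV P >-> RR}) (a : 'I_n -> 'rV[RR]_d) (w : T) : 'rV[RR]_d :=
  \sum_(k < n) X k w *: a k.

Definition concQ d0 (T : measurableType d0) (P : probability T RR) (d : nat)
    (Y : T -> 'rV[RR]_d) (lambda : RR) : \bar RR :=
  ereal_sup [set P [set w | enorm (Y w - x) <= lambda] | x in [set: 'rV[RR]_d]].

Definition Nmat (n d : nat) (a : 'I_n -> 'rV[RR]_d) : 'M[RR]_d :=
  \sum_(k < n) (a k)^T *m a k.

(* Main.v *)
(* Approximate the common law by a finitely supported one, so that every
   expectation becomes a finite sum, and average over the grid of differences
   [(j - j') / K], [j, j' in {0..K-1}^d], in place of the cube [-1, 1]^d.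

   Esseen's inequality bounds Q(F_a, sqrt d) by the average of
     |f_a(t)| <= exp (- (1/2) E psi_Z(t)),
     psi_z(t) = sum_k (1 - cos (2 pi z <t, a_k>)),   Z = X_1 - X_2.
   Jensen's inequality for the law of Z reweighted by min(z^2, 1) / M reduces
   this to a single z and the average of exp (- M psi_z(t) / (2 min(z^2, 1))).
   If |z| <= 1, then z t stays in the cube, so either every |<z t, a_k>| is
   below 1/2 and psi_z(t) >= 2 z^2 <t, N t>, or the hypothesis gives
   psi_z(t) >= 2 alpha^2; the two cases produce a Gaussian sum, of order
   C^d / sqrt (det N), and the exponential term.
   If |z| > 1, exp (- M psi_1 / 2) is dominated by the characteristic function
   of a lazy walk with steps in {- a_k, 0, a_k}, and the concentration function
   of z times the walk is at most that of the walk: the factor z is removed by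
   going back from characteristic functions to probabilities. *)

Require Import Defs.
From HB Require Import structures.
From mathcomp Require Import all_boot all_order all_algebra.
From mathcomp Require Import all_classical all_reals all_analysis.
From mathcomp Require Import Rstruct Rstruct_topology.
From mathcomp Require Import complex ring lra.
Import Order.TTheory GRing.Theory Num.Theory.
Import numFieldNormedType.Exports ComplexField Normc.
From mathcomp Require Import measurable_realfun exp trigo.
Local Open Scope classical_set_scope.
Local Open Scope ring_scope.

Set Implicit Arguments.
Unset Strict Implicit.
Unset Printing Implicit Defensive.

(** * Trigonometric inequalities and complex exponentials *)

Section Trigonometry.
Variable R : realType.
Implicit Types x y : R.

Lemma eqW x y : x = y -> x <= y.
Proof. by move=> ->. Qed.

Lemma sin_ge_half x : 0 <= x <= pi / 2 -> x / 2 <= sin x.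
Proof.
move=> /andP[x0 xpi].
have [->|xn0] := eqVneq x 0; first by rewrite sin0 mul0r.
have xp : 0 < x by rewrite lt_neqAle eq_sym xn0.
have pi0 := pi_gt0 R.
(* half angle: [sin x = 2 sin (x/2) cos (x/2) >= x cos (x/2) ^+ 2] *)
have h2 : x / 2 * cos (x / 2) <= sin (x / 2).
  have [c cin] : exists2 c, c \in `]0, x / 2[ &
      sin (x / 2) - sin 0 = cos c * (x / 2 - 0).
    apply: MVT; first by lra.
    by apply: continuous_subspaceT => z; exact: continuous_sin.
  rewrite sin0 !subr0 => ->; rewrite mulrC ler_pM2r; last by lra.
  move: cin; rewrite in_itv /= => /andP[c0 cx].
  apply/ltW; rewrite ltr_cos ?in_itv //=; apply/andP; split; lra.
have -> : sin x = 2 * (cos (x / 2) * sin (x / 2)).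
  have -> : x = (x / 2) *+ 2 by rewrite -mulr_natr; lra.
  rewrite sin_mulr2n; have -> : x / 2 *+ 2 / 2 = x / 2 by rewrite -mulr_natr; lra.
  by rewrite [RHS]mulr_natl.
have c0 : 0 <= cos (x / 2) by apply: cos_ge0_pihalf; apply/andP; split; lra.
have cx : 0 <= cos x by apply: cos_ge0_pihalf; apply/andP; split; lra.
have cc : cos x = cos (x / 2) ^+ 2 *+ 2 - 1.
  rewrite -cos_mulr2n; congr cos; by rewrite -mulr_natr; lra.
rewrite -mulr_natr in cc.
have : x / 2 * cos (x / 2) * cos (x / 2) <= sin (x / 2) * cos (x / 2).
  by apply: ler_wpM2r.
rewrite expr2 in cc; nra.
Qed.

Lemma sqr_sin_ge x : `|x| <= pi / 2 -> x ^+ 2 / 4 <= sin x ^+ 2.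
Proof.
move=> xpi; have h : 0 <= `|x| <= pi / 2 by rewrite normr_ge0.
have := sin_ge_half h.
have -> : sin x ^+ 2 = sin `|x| ^+ 2.
  by case: (leP 0 x) => ?; [rewrite ger0_norm | rewrite ltr0_norm // sinN sqrrN].
rewrite -(real_normK (num_real x)) => hs; have := normr_ge0 x; nra.
Qed.

(** By the half-angle formula and the sine bound, [1 - cos (2 pi x) = 2 sin (pi x)^2 >= pi^2 x^2 /
    2], and [pi >= 2]. *)
Lemma one_sub_cos_ge x : `|x| <= 1 / 2 -> 2 * x ^+ 2 <= 1 - cos (2 * pi * x).
Proof.
move=> hx; have p2 := pi_ge2 R.
have -> : 2 * pi * x = (pi * x) *+ 2 by rewrite -mulr_natr; ring.
rewrite cos_mulr2n cos2sin2.
have /sqr_sin_ge : `|pi * x| <= pi / 2.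
  rewrite normrM ger0_norm ?pi_ge0 //; nra.
rewrite exprMn -mulr_natr.
have : 4 * x ^+ 2 <= pi ^+ 2 * x ^+ 2.
  by rewrite ler_wpM2r ?sqr_ge0 // ; nra.
lra.
Qed.

Lemma cos_addz x (m : int) : cos (2 * pi * (x - m%:~R)) = cos (2 * pi * x).
Proof.
have per n (z : R) : cos (z + (2 * pi) * n%:R) = cos z.
  have := periodicn (@cosD2pi R) n z.
  by rewrite -mulrnA -(mulr_natr pi (2 * n)) natrM mulrA (mulrC pi).
case: m => n.
  by rewrite -(per n) -pmulrn; congr cos; ring.
by rewrite NegzE mulrNz opprK -(per n.+1 (2 * pi * x)) -pmulrn mulrDr.
Qed.

Lemma int_near x : exists m : int, `|x - m%:~R| <= 1 / 2.
Proof.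
exists (Num.floor (x + 1 / 2)).
have := floor_itv (x + 1 / 2); rewrite intrD => /andP[h1 h2].
rewrite ler_norml; apply/andP; split; lra.
Qed.

Definition cis x : R[i] := Complex (cos x) (sin x).

Lemma cisD x y : cis (x + y) = cis x * cis y.
Proof. by rewrite /cis cosD sinD /= [sin x * _ + _]addrC. Qed.

Lemma cis0 : cis 0 = 1.
Proof. by rewrite /cis cos0 sin0. Qed.

Lemma cisMn x n : cis (x *+ n) = cis x ^+ n.
Proof.
by elim: n => [|n IH]; rewrite ?mulr0n ?cis0 // mulrS exprS cisD IH.
Qed.

Lemma cis_sum (I : finType) (F : I -> R) :
  cis (\sum_i F i) = \prod_i cis (F i).
Proof. exact: (big_morph cis cisD cis0). Qed.

Lemma normc_cis x : normc (cis x) = 1.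
Proof. by rewrite /normc /= cos2Dsin2 sqrtr1. Qed.

Lemma Re_sum (I : finType) (F : I -> R[i]) :
  complex.Re (\sum_i F i) = \sum_i complex.Re (F i).
Proof. by apply: (big_morph (@complex.Re R)) => // -[? ?] [? ?]. Qed.

Lemma Im_sum (I : finType) (F : I -> R[i]) :
  complex.Im (\sum_i F i) = \sum_i complex.Im (F i).
Proof. by apply: (big_morph (@complex.Im R)) => // -[? ?] [? ?]. Qed.

Lemma normc_prod (I : finType) (F : I -> R[i]) :
  normc (\prod_i F i) = \prod_i normc (F i).
Proof. exact: (big_morph (@normc R) (@normcM R) (normc1 R)). Qed.

Lemma Re_le_normc (z : R[i]) : complex.Re z <= normc z.
Proof.
case: z => a b /=; apply: le_trans (ler_norm a) _.
by rewrite -sqrtr_sqr ler_wsqrtr // lerDl sqr_ge0.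
Qed.

Lemma normc_sqr (z : R[i]) :
  normc z ^+ 2 = complex.Re z ^+ 2 + complex.Im z ^+ 2.
Proof. by case: z => a b /=; rewrite sqr_sqrtr // addr_ge0 ?sqr_ge0. Qed.

Lemma normc_ge0 (z : R[i]) : 0 <= normc z.
Proof. by case: z => a b; exact: sqrtr_ge0. Qed.

Lemma ReZ (q : R) (z : R[i]) : complex.Re (real_complex R q * z) = q * complex.Re z.
Proof. by case: z => a b /=; rewrite mul0r subr0. Qed.

Lemma ImZ (q : R) (z : R[i]) : complex.Im (real_complex R q * z) = q * complex.Im z.
Proof. by case: z => a b /=; rewrite mul0r addr0. Qed.

(** For probability weights [q] this is symmetrization: the squared modulus of a characteristic
    function is the characteristic function of the difference of two independent copies. *)
Lemma sqr_normc_sum_cis (I : finType) (q : I -> R) (x : I -> R) :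
  normc (\sum_i real_complex R (q i) * cis (x i)) ^+ 2 =
  \sum_i \sum_j q i * q j * cos (x i - x j).
Proof.
rewrite normc_sqr Re_sum Im_sum !expr2.
under eq_bigr do rewrite ReZ.
under [X in _ + X * _ = _]eq_bigr do rewrite ImZ.
rewrite !mulr_suml -big_split; apply: eq_bigr => i _ /=.
rewrite !mulr_sumr -big_split; apply: eq_bigr => j _ /=.
by rewrite cosB; ring.
Qed.

End Trigonometry.

(** * Averages over differences of grid points *)

Section GridAverages.
Variable R : realType.
Implicit Types (d K : nat).

Definition dot d (u v : 'rV[R]_d) : R := \sum_i u 0 i * v 0 i.

Lemma dotBr d (t u v : 'rV[R]_d) : dot t (u - v) = dot t u - dot t v.
Proof. by rewrite /dot -sumrB; apply: eq_bigr => i _; rewrite !mxE mulrBr. Qed.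

Lemma dot_sumr d (I : finType) (t : 'rV[R]_d) (u : I -> 'rV[R]_d) :
  dot t (\sum_k u k) = \sum_k dot t (u k).
Proof.
rewrite /dot exchange_big; apply: eq_bigr => i _.
by rewrite summxE mulr_sumr.
Qed.

Lemma dotZr d c (t u : 'rV[R]_d) : dot t (c *: u) = c * dot t u.
Proof.
by rewrite /dot mulr_sumr; apply: eq_bigr => i _; rewrite mxE mulrCA.
Qed.

Lemma dotZl d c (t u : 'rV[R]_d) : dot (c *: t) u = c * dot t u.
Proof.
by rewrite /dot mulr_sumr; apply: eq_bigr => i _; rewrite mxE mulrA.
Qed.

(** Taking differences of grid points makes the average of a character a squared modulus, hence
    nonnegative. *)
Definition grid_point d K (j j' : {ffun 'I_d -> 'I_K}) : 'rV[R]_d :=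
  \row_i (((j i)%:R - (j' i)%:R) / K%:R).

(* Discrete analogue of [\int_([-1, 1]^d) G(t) \prod_i (1 - |t i|) dt]. *)
Definition grid_avg d K (G : 'rV[R]_d -> R) : R :=
  (\sum_(j : {ffun 'I_d -> 'I_K}) \sum_(j' : {ffun 'I_d -> 'I_K})
     G (grid_point j j')) / (K%:R ^+ d) ^+ 2.

Lemma grid_point_le1 d K (j j' : {ffun 'I_d -> 'I_K}) i :
  `|grid_point j j' 0 i| <= 1.
Proof.
rewrite mxE normrM normfV (ger0_norm (ler0n R K)).
have K0 : (0 < K)%N by apply: leq_trans (ltn_ord (j i)).
have jK (k : 'I_K) : 0 <= ((k : nat)%:R : R) <= K%:R.
  by rewrite ler0n ler_nat ltnW.
rewrite ler_pdivrMr ?ltr0n // mul1r ler_norml.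
have /andP[? ?] := jK (j i); have /andP[? ?] := jK (j' i).
by apply/andP; split; lra.
Qed.

Lemma grid_avg_le d K (G H : 'rV[R]_d -> R) :
  (forall t : 'rV[R]_d, (forall i, `|t 0 i| <= 1) -> G t <= H t) ->
  grid_avg K G <= grid_avg K H.
Proof.
move=> GH; rewrite /grid_avg ler_wpM2r ?invr_ge0 ?sqr_ge0 //.
by apply: ler_sum => j _; apply: ler_sum => j' _; apply: GH; exact: grid_point_le1.
Qed.

Lemma grid_avg_ge0 d K (G : 'rV[R]_d -> R) :
  (forall t, 0 <= G t) -> 0 <= grid_avg K G.
Proof.
move=> G0; rewrite mulr_ge0 ?invr_ge0 ?sqr_ge0 //.
by apply: sumr_ge0 => j _; apply: sumr_ge0.
Qed.

Lemma grid_avg_sum d K (I : finType) (q : I -> R) (G : I -> 'rV[R]_d -> R) :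
  grid_avg K (fun t => \sum_f q f * G f t) = \sum_f q f * grid_avg K (G f).
Proof.
rewrite /grid_avg.
under eq_bigr => j _.
  rewrite exchange_big /=; under eq_bigr do rewrite -mulr_sumr.
  over.
rewrite exchange_big mulr_suml; apply: eq_bigr => f _ /=.
by rewrite -mulr_sumr mulrA.
Qed.

Lemma grid_avgZ d K c (G : 'rV[R]_d -> R) :
  grid_avg K (fun t => c * G t) = c * grid_avg K G.
Proof.
rewrite /grid_avg mulrA mulr_sumr; congr (_ / _); apply: eq_bigr => j _.
by rewrite mulr_sumr.
Qed.

Lemma grid_avgD d K (G H : 'rV[R]_d -> R) :
  grid_avg K (fun t => G t + H t) = grid_avg K G + grid_avg K H.
Proof.
rewrite /grid_avg -mulrDl -big_split; congr (_ / _); apply: eq_bigr => j _ /=.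
exact: big_split.
Qed.

Lemma grid_avg_const d K (c : R) : (0 < K)%N ->
  grid_avg K (fun _ : 'rV[R]_d => c) = c.
Proof.
move=> K0; rewrite /grid_avg !sumr_const card_ffun !card_ord -mulrnA.
by rewrite -[c *+ _]mulr_natr natrM natrX -expr2 mulfK // sqrf_eq0 expf_neq0 // pnatr_eq0 -lt0n.
Qed.

(** * The Fejer kernel: lower bound near the origin and decay away from it *)

Definition fejer K (y : R) : R :=
  normc (\sum_(j < K) cis (2 * pi * (j%:R / K%:R * y))) ^+ 2 / K%:R ^+ 2.

Lemma fejerE K y : fejer K y =
  (\sum_(j < K) \sum_(j' < K)
    cos (2 * pi * ((j%:R - j'%:R) / K%:R * y))) / K%:R ^+ 2.
Proof.
have := sqr_normc_sum_cis (fun=> 1) (fun j : 'I_K => 2 * pi * (j%:R / K%:R * y)).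
under eq_bigr do rewrite rmorph1 mul1r.
rewrite /fejer => ->; congr (_ / _).
apply: eq_bigr => j _; apply: eq_bigr => j' _.
by rewrite !mul1r -mulrBr -mulrBl -mulrBl.
Qed.

Lemma fejer_ge0 K y : 0 <= fejer K y.
Proof. by rewrite mulr_ge0 ?invr_ge0 ?sqr_ge0. Qed.

Lemma fejer_le1 K y : (0 < K)%N -> fejer K y <= 1.
Proof.
move=> K0; rewrite fejerE ler_pdivrMr ?exprn_gt0 ?ltr0n // mul1r.
apply: (@le_trans _ _ (\sum_(j < K) \sum_(j' < K) 1)).
  by apply: ler_sum => j _; apply: ler_sum => j' _; exact: cos_le1.
by rewrite !sumr_const card_ord -mulrnA -natrX mulnn.
Qed.

Lemma fejer_ge_half K y : (0 < K)%N -> `|y| <= 1 / 8 -> 1 / 2 <= fejer K y.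
Proof.
move=> K0 hy; rewrite fejerE ler_pdivlMr ?exprn_gt0 ?ltr0n //.
apply: (@le_trans _ _ (\sum_(j < K) \sum_(j' < K) 1 / 2)).
  by rewrite !sumr_const card_ord -mulrnA mulnn mulrC -natrX mulr_natl.
apply: ler_sum => j _; apply: ler_sum => j' _.
set w := _ / _ * y.
have hw : `|w| <= 1 / 8.
  have := grid_point_le1 [ffun=> j] [ffun=> j'] (0 : 'I_1).
  rewrite !mxE !ffunE /w normrM => h1; apply: le_trans hy.
  by rewrite -[leRHS]mul1r [leLHS]normrM ler_wpM2r // normrM.
have p0 := pi_gt0 R; move: hw; rewrite ler_norml => /andP[w1 w2].
have c0 : 0 <= cos (2 * pi * w) by apply: cos_ge0_pihalf; apply/andP; split; nra.
(* The doubled angle stays within [pi / 2], so [2 c^2 - 1 >= 0], which with [c >= 0] forces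
   [c >= 1/2]. *)
have : 0 <= cos (2 * pi * w *+ 2).
  by apply: cos_ge0_pihalf; rewrite -mulr_natr; apply/andP; split; nra.
rewrite cos_mulr2n -mulr_natr expr2; nra.
Qed.

(** For a geometric sum, the squared modulus times [|cis th - 1|^2 >= 4 (y / K)^2] equals
    [|cis (K th) - 1|^2 <= 4]. The condition [|y| <= K / 2] keeps [y] within half a period of the
    kernel. *)
Lemma fejer_le_inv K y : y != 0 -> `|y| <= K%:R / 2 -> fejer K y <= 1 / y ^+ 2.
Proof.
move=> y0 hy.
have yp : 0 < `|y| by rewrite normr_gt0.
have K0 : 0 < (K%:R : R) by lra.
pose th := 2 * pi * (y / K%:R).
have -> : fejer K y = normc (\sum_(j < K) cis th ^+ j) ^+ 2 / K%:R ^+ 2.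
  congr (normc _ ^+ 2 / _); apply: eq_bigr => j _.
  have -> : 2 * pi * (j%:R / K%:R * y) = th *+ j.
    by rewrite -mulr_natr /th; ring.
  exact: cisMn.
have sq z : normc (cis z - 1 : R[i]) ^+ 2 = 2 * (1 - cos z).
  rewrite normc_sqr /= oppr0 addr0.
  by have := cos2Dsin2 z; lra.
have := congr1 (fun z => normc z ^+ 2) (subrX1 (cis th) K).
rewrite normcM exprMn -cisMn !sq.
set S := normc _ ^+ 2; have S0 : 0 <= S by rewrite sqr_ge0.
have : 2 * (y / K%:R) ^+ 2 <= 1 - cos th.
  apply: one_sub_cos_ge; rewrite normrM normfV (ger0_norm (ltW K0)).
  by rewrite ler_pdivrMr //; lra.
have := cos_geN1 (th *+ K).
move=> h1 h2 h3.
have h4 : S * (y / K%:R) ^+ 2 <= 1 by nra.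
rewrite ler_pdivlMr ?exprn_even_gt0 //.
by move: h4; rewrite expr_div_n mulrA mulrAC.
Qed.

(** The index [l] numbers the layers [l <= 4 |y| < l + 1]; the product in the denominator makes the
    sum over layers telescope. *)
Definition decay (l : nat) : R := 2 ^+ 6 / ((l%:R + 1) * (l%:R + 2)).

Lemma fejer_le_decay K y : (0 < K)%N -> `|y| <= K%:R / 2 ->
  fejer K y <= decay (Num.truncn (4 * `|y|)).
Proof.
move=> K0 hy; rewrite /decay; set l := (Num.truncn _)%:R.
have : 0 <= 4 * `|y| by rewrite mulr_ge0.
move=> /truncn_itv; rewrite -/l => /andP[l1 _].
have l0 : 0 <= l by rewrite ler0n.
(* The trivial bound 1 suffices for [l <= 2], where [(l + 1) (l + 2) <= 12]; beyond, [|y| >= l / 4]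
   turns [1 / y^2] into [16 / l^2]. *)
have [l2|l2] := leP l 2.
  apply: le_trans (fejer_le1 y K0) _; rewrite ler_pdivlMr ?mulr_gt0 //; nra.
have yp : 0 < `|y| by lra.
apply: le_trans (fejer_le_inv _ hy) _; first by rewrite -normr_gt0.
rewrite -(real_normK (num_real y)) ler_pdivlMr ?mulr_gt0 //; try lra.
rewrite mulrAC ler_pdivrMr ?exprn_gt0 //; nra.
Qed.

Lemma sum_decay m : \sum_(l < m) decay l <= 2 ^+ 6.
Proof.
suff -> : \sum_(l < m) decay l = 2 ^+ 6 * (1 - (m%:R + 1)^-1).
  rewrite ler_piMr ?exprn_ge0 // gerBl invr_ge0 addr_ge0 //.
elim: m => [|m IH]; first by rewrite big_ord0 add0r invr1 subrr mulr0.
rewrite big_ord_recr /= IH /decay -natr1.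
have m0 : 0 <= (m%:R : R) by rewrite ler0n.
by field; apply/andP; split; apply/lt0r_neq0; lra.
Qed.

(** Expanding the product of the coordinate sums gives a single sum over the grid, whose squared
    modulus is the double sum in [grid_avg]. *)
Lemma grid_avg_cos d K (u : 'rV[R]_d) :
  grid_avg K (fun t => cos (2 * pi * dot t u)) = \prod_i fejer K (u 0 i).
Proof.
rewrite /fejer big_split /= prodfV /= prodrXl -normc_prod.
rewrite prodr_const card_ord exprAC /grid_avg; congr (_ / _).
rewrite bigA_distr_bigA /=.
have prodE (f : {ffun 'I_d -> 'I_K}) :
    \prod_i cis (2 * pi * ((f i)%:R / K%:R * u 0 i)) =
    real_complex R 1 * cis (\sum_i 2 * pi * ((f i)%:R / K%:R * u 0 i)).
  by rewrite rmorph1 mul1r cis_sum.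
under [in RHS]eq_bigr do rewrite prodE.
rewrite (sqr_normc_sum_cis (fun=> 1)); apply: eq_bigr => j _.
apply: eq_bigr => j' _; rewrite !mul1r -sumrB /dot mulr_sumr; congr cos.
by apply: eq_bigr => i _; rewrite mxE; ring.
Qed.

(** * Esseen's inequality and coverings by cubes *)

Definition in_cube d (y : 'I_d -> R) (u : 'rV[R]_d) : bool :=
  [forall i, `|u 0 i - y i| <= 1 / 8].

(** On the cube every kernel factor at [s f - y] is at least 1/2, so [2 ^+ d] times their product
    dominates the indicator. That product is a grid average of cosines, whose sum over [f] is the
    real part of a rotated characteristic function. *)
Lemma esseen_cube d K (F : finType) (q : F -> R) (s : F -> 'rV[R]_d) y :
  (0 < K)%N -> (forall f, 0 <= q f) ->
  \sum_(f | in_cube y (s f)) q f <=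
  2 ^+ d * grid_avg K (fun t =>
    normc (\sum_f real_complex R (q f) * cis (2 * pi * dot t (s f)))).
Proof.
move=> K0 q0.
pose yv : 'rV[R]_d := \row_i y i.
apply: (@le_trans _ _ (2 ^+ d * grid_avg K (fun t =>
    \sum_f q f * cos (2 * pi * dot t (s f - yv))))); last first.
  rewrite ler_pM2l ?exprn_gt0 //; apply: grid_avg_le => t _.
  set S := (X in normc X).
  (* A phase factor recentres the sum at [yv] without changing its modulus. *)
  have -> : normc S = normc (cis (- (2 * pi * dot t yv)) * S).
    by rewrite normcM normc_cis mul1r.
  apply: le_trans (Re_le_normc _); rewrite mulr_sumr Re_sum.
  apply: ler_sum => f _; rewrite mulrCA -cisD ReZ /=.
  by rewrite dotBr mulrBr addrC.
rewrite grid_avg_sum mulr_sumr big_mkcond /=; apply: ler_sum => f _.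
rewrite grid_avg_cos mulrCA.
have P0 : 0 <= \prod_i fejer K ((s f - yv) 0 i).
  by apply: prodr_ge0 => i _; exact: fejer_ge0.
case: ifPn => [/forallP fy|_]; last by rewrite !mulr_ge0 ?exprn_ge0.
rewrite -[leLHS]mulr1 ler_wpM2l //.
have -> : (2 : R) ^+ d = \prod_(i < d) 2 by rewrite prodr_const card_ord.
rewrite -big_split /=.
rewrite -[leLHS](big1_eq (R := R) (op := *%R) (index_enum 'I_d) xpredT).
apply: ler_prod => i _; rewrite ler01 /=.
have := fejer_ge_half K0 (fy i); rewrite !mxE; lra.
Qed.

(** Space is cut into cells of side 1/4, labelled in each coordinate by the layer of [|u f 0 i|] and
    a sign. On a cell [w] is at most a product of values of [g], and the cell lies in a cube of mass
    at most [B]. Summing the products over all labels gives at most [(2 * G) ^+ d], the 2 counting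
    signs. *)
Lemma cover_sum d (F : finType) (q : F -> R) (u : F -> 'rV[R]_d)
    (w : F -> R) (g : nat -> R) (G B : R) :
  (forall f, 0 <= q f) -> (forall l, 0 <= g l) ->
  (forall m, \sum_(l < m) g l <= G) ->
  (forall f, w f <= \prod_i g (Num.truncn (4 * `|u f 0 i|))) ->
  (forall y, \sum_(f | in_cube y (u f)) q f <= B) ->
  \sum_f q f * w f <= (2 * G) ^+ d * B.
Proof.
move=> q0 g0 gG wg cubeB.
have B0 : 0 <= B by apply: le_trans (cubeB (fun=> 0)); exact: sumr_ge0.
pose l f i := Num.truncn (4 * `|u f 0 i|).
(* Only finitely many layers are occupied, so the labels form a finite type. *)
pose m := (\max_f \max_i l f i)%N.
have lm f i : (l f i < m.+1)%N.
  rewrite ltnS; apply: leq_trans (leq_bigmax f).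
  exact: (@leq_bigmax _ (l f) i).
pose idx f : {ffun 'I_d -> 'I_m.+1 * bool} :=
  [ffun i => (inord (l f i), 0 <= u f 0 i)].
apply: (@le_trans _ _ (\sum_f q f * \prod_i g (idx f i).1)).
  apply: ler_sum => f _; rewrite ler_wpM2l //; apply: le_trans (wg f) _.
  by apply/eqW/eq_bigr => i _; rewrite ffunE /= inordK.
rewrite (partition_big idx predT) //=.
apply: (@le_trans _ _ (\sum_(L : {ffun 'I_d -> 'I_m.+1 * bool})
    (\prod_i g (L i).1) * B)).
  apply: ler_sum => L _.
  (* The centre of the cell labelled [L]. *)
  pose y i : R := (if (L i).2 then 1 else -1) * (((L i).1%:R + 1 / 2) / 4).
  have P0 : 0 <= \prod_i g (L i).1 by exact: prodr_ge0.
  apply: (@le_trans _ _ ((\prod_i g (L i).1) * \sum_(f | idx f == L) q f)).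
    rewrite mulr_sumr; apply: ler_sum => f /eqP ->.
    by rewrite mulrC.
  rewrite ler_wpM2l //; apply: le_trans (cubeB y).
  rewrite [leLHS]big_mkcond [leRHS]big_mkcond; apply: ler_sum => f _.
  case: ifPn => [/eqP fL|_]; last by case: ifP.
  suff -> : in_cube y (u f) by [].
  apply/forallP => i; rewrite /y -fL ffunE /= inordK //.
  have : 0 <= 4 * `|u f 0 i| by rewrite mulr_ge0.
  move=> /truncn_itv; rewrite -/(l f i) -[(l f i).+1%:R]natr1 => /andP[h1 h2].
  rewrite ler_norml; case: (leP 0 (u f 0 i)) h1 h2 => [u0|u0].
    by rewrite ger0_norm // => ? ?; apply/andP; split; lra.
  by rewrite ltr0_norm // => ? ?; apply/andP; split; lra.
rewrite -mulr_suml ler_wpM2r //.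
rewrite -(bigA_distr_bigA (fun (_ : 'I_d) (p : 'I_m.+1 * bool) => g p.1)) prodr_const card_ord.
have S0 : 0 <= \sum_(p : 'I_m.+1 * bool) g p.1 by exact: sumr_ge0.
rewrite lerXn2r ?nnegrE //.
  by rewrite mulr_ge0 //; apply: le_trans (gG 0%N); rewrite big_ord0.
rewrite -(pair_bigA _ (fun (a : 'I_m.+1) (b : bool) => g a)) /=.
under eq_bigr do rewrite sumr_const card_bool -mulr_natl.
by rewrite -mulr_sumr ler_pM2l //; exact: gG.
Qed.

(** The layer [l] of a coordinate [u] satisfies [l <= 4 |u| <= u^2 + 4], so on the ball the layers
    add up to at most [8 d], and the product of the weights [2^8 / 2^l] is at least 1. These weights
    sum to at most [2^9]: the covering costs [(2 * 2^9)^d], and [esseen_cube] a further [2^d]. *)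
Lemma esseen_ball d K (F : finType) (q : F -> R) (s : F -> 'rV[R]_d) (y : 'rV[R]_d) :
  (0 < K)%N -> (forall f, 0 <= q f) ->
  \sum_(f | dot (s f - y) (s f - y) <= 4 * d%:R) q f <=
  (2 ^+ 11) ^+ d * grid_avg K (fun t =>
    normc (\sum_f real_complex R (q f) * cis (2 * pi * dot t (s f)))).
Proof.
move=> K0 q0; set A := grid_avg _ _.
pose g (l : nat) : R := 2 ^+ 8 / 2 ^+ l.
have -> : (2 ^+ 11 : R) ^+ d * A = (2 * 2 ^+ 9) ^+ d * (2 ^+ d * A).
  by rewrite mulrA -exprMn -exprS -exprSr.
rewrite big_mkcond /=.
rewrite (eq_bigr (fun f => q f *
    (if dot (s f - y) (s f - y) <= 4 * d%:R then 1 else 0))); last first.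
  by move=> f _; case: ifP => _; rewrite ?mulr1 ?mulr0.
apply: (@cover_sum _ _ _ (fun f => s f - y) _ g) => //.
- by move=> l; rewrite divr_ge0 ?exprn_ge0.
- move=> m; suff -> : \sum_(l < m) g l = 2 ^+ 9 - 2 ^+ 9 / 2 ^+ m.
    by rewrite gerBl divr_ge0 ?exprn_ge0.
  elim: m => [|m IH]; first by rewrite big_ord0 expr0 divr1 subrr.
  rewrite big_ord_recr /= IH /g (exprS _ m) [2 ^+ 9]exprS; field.
  by rewrite expf_neq0.
- move=> f; set u := s f - y.
  case: ifPn => [hu|_]; last first.
    by apply: prodr_ge0 => i _; rewrite divr_ge0 ?exprn_ge0.
  rewrite /g big_split /= prodr_const card_ord prodfV prodrXr.
  rewrite ler_pdivlMr ?exprn_gt0 // mul1r.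
  rewrite -exprM ler_weXn2l ?ler1n // -(ler_nat R) natr_sum natrM mulrC.
  apply: (@le_trans _ _ (\sum_(i < d) (u 0 i * u 0 i + 4))).
    apply: ler_sum => i _.
    have : 0 <= 4 * `|u 0 i| by rewrite mulr_ge0.
    move=> /truncn_itv /andP[h1 _]; apply: le_trans h1 _.
    have := real_normK (num_real (u 0 i)); rewrite !expr2.
    have := sqr_ge0 (`|u 0 i| - 2); rewrite expr2; nra.
  by rewrite big_split /= -/(dot u u) sumr_const card_ord -mulr_natr; lra.
- move=> yy; have := @esseen_cube d K F q s (fun i => yy i + y 0 i) K0 q0.
  apply: le_trans; apply/eqW/eq_bigl => f; apply: eq_forallb => i.
  by rewrite !mxE; congr (`|_| <= _); ring.
Qed.

End GridAverages.

(** * Characteristic functions of sums of independent variables *)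

Section CharacteristicFunctions.
Variable R : realType.

(** The mass of the outcome [f] under the [n]-fold product of the law [p]. *)
Definition wt n (I : finType) (p : I -> R) (f : {ffun 'I_n -> I}) : R :=
  \prod_k p (f k).

Definition lin_comb n d (I : finType) (x : I -> R) (a : 'I_n -> 'rV[R]_d)
    (f : {ffun 'I_n -> I}) : 'rV[R]_d := \sum_k x (f k) *: a k.

Lemma char_prod n d (I : finType) (p x : I -> R) (a : 'I_n -> 'rV[R]_d) (t : 'rV[R]_d) :
  \sum_(f : {ffun 'I_n -> I})
     real_complex R (wt p f) * cis (2 * pi * dot t (lin_comb x a f)) =
  \prod_k \sum_i real_complex R (p i) * cis (x i * (2 * pi * dot t (a k))).
Proof.
rewrite bigA_distr_bigA /=; apply: eq_bigr => f _.
rewrite big_split /= /wt rmorph_prod; congr (_ * _).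
rewrite -cis_sum dot_sumr mulr_sumr; congr cis.
by apply: eq_bigr => k _; rewrite dotZr mulrCA.
Qed.

(** The squared modulus is [1 - u], with [u] the mean of [1 - cos] over two independent copies, and
    [1 - u <= exp (- u)]. *)
Lemma normc_char_le (I : finType) (p x : I -> R) (th : R) :
  \sum_i p i = 1 ->
  normc (\sum_i real_complex R (p i) * cis (x i * th)) <=
  expR (- (1 / 2 * \sum_(ij : I * I)
    p ij.1 * p ij.2 * (1 - cos ((x ij.1 - x ij.2) * th)))).
Proof.
move=> p1; set u := \sum_(ij : I * I) _.
rewrite -(ler_pXn2r (ltn0Sn 1)) ?nnegrE ?normc_ge0 ?expR_ge0 //.
rewrite sqr_normc_sum_cis -expRM_natl mulrN mulrA mulrCA divff // mulr1 mul1r.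
apply: le_trans (expR_ge1Dx (- u)); apply/eqW.
have -> : 1 = \sum_(ij : I * I) p ij.1 * p ij.2.
  rewrite -(pair_bigA _ (fun i j => p i * p j)) /=.
  under eq_bigr do rewrite -mulr_sumr p1 mulr1.
  by rewrite p1.
rewrite pair_bigA /u -sumrB; apply: eq_bigr => ij _ /=.
by rewrite -mulrBl; ring.
Qed.

Definition psi n d (a : 'I_n -> 'rV[R]_d) (z : R) (t : 'rV[R]_d) : R :=
  \sum_k (1 - cos (2 * pi * (z * dot t (a k)))).

Lemma normc_char_prod_le n d (I : finType) (p x : I -> R)
    (a : 'I_n -> 'rV[R]_d) (t : 'rV[R]_d) :
  \sum_i p i = 1 ->
  normc (\sum_(f : {ffun 'I_n -> I})
     real_complex R (wt p f) * cis (2 * pi * dot t (lin_comb x a f))) <=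
  expR (- (1 / 2 * \sum_(ij : I * I) p ij.1 * p ij.2 * psi a (x ij.1 - x ij.2) t)).
Proof.
move=> p1; rewrite char_prod normc_prod.
have -> : - (1 / 2 * \sum_(ij : I * I) p ij.1 * p ij.2 * psi a (x ij.1 - x ij.2) t)
  = \sum_k - (1 / 2 * \sum_(ij : I * I) p ij.1 * p ij.2 *
       (1 - cos ((x ij.1 - x ij.2) * (2 * pi * dot t (a k))))).
  rewrite sumrN -mulr_sumr exchange_big /=; congr (- (_ * _)).
  apply: eq_bigr => ij _; rewrite /psi mulr_sumr; apply: eq_bigr => k _.
  by congr (_ * (1 - cos _)); ring.
rewrite expR_sum; apply: ler_prod => k _.
by rewrite normc_ge0 normc_char_le.
Qed.

(* Jensen's inequality for [exp] in the probability weights [w j * r j / M],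
   obtained from the tangent line of [exp] at the mean. *)
Lemma grid_avg_jensen d K (J : finType) (w r : J -> R)
    (psi : J -> 'rV[R]_d -> R) (M B : R) :
  (forall j, 0 <= w j) -> (forall j, 0 <= r j) ->
  (forall j, r j = 0 -> forall t, psi j t = 0) ->
  M = \sum_j w j * r j -> 0 < M ->
  (forall j, 0 < r j -> grid_avg K (fun t => expR (- (1 / 2 * M * psi j t / r j))) <= B) ->
  grid_avg K (fun t => expR (- (1 / 2 * \sum_j w j * psi j t))) <= B.
Proof.
move=> w0 r0 psi0 ME M0 hB.
pose A t := 1 / 2 * \sum_j w j * psi j t.
rewrite -(ler_pM2l M0) -grid_avgZ.
(* The weights [w j * r j] add up to [M] and the terms [w j * psi j t] to [2 * A t], so the tangent
   values recombine to exactly [M * expR (- A t)]. *)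
have -> : (fun t => M * expR (- (1 / 2 * \sum_j w j * psi j t))) =
    (fun t => \sum_j w j * (expR (- A t) * (r j * (1 + A t) - 1 / 2 * M * psi j t))).
  apply/funext => t; rewrite -/(A t).
  have -> : M * expR (- A t) = expR (- A t) * (M * (1 + A t) - M * A t).
    by ring.
  rewrite {1}ME /A mulr_suml !mulr_sumr -sumrB mulr_sumr.
  by apply: eq_bigr => j _; ring.
rewrite grid_avg_sum [X in _ <= X * _]ME mulr_suml; apply: ler_sum => j _.
rewrite -[w j * r j * B]mulrA; apply: ler_wpM2l => //.
(* Where [r j] vanishes, so does [psi j], and the term contributes nothing. *)
have := r0 j; rewrite le_eqVlt => /orP[/eqP rj|rj].
  rewrite -rj mul0r (_ : (fun t => _) = (fun _ => 0)).
    by rewrite /grid_avg !big1 ?mul0r // => i _; rewrite big1.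
  by apply/funext => t; rewrite psi0 // mulr0 mul0r subr0 mulr0.
apply: (@le_trans _ _ (r j *
    grid_avg K (fun t => expR (- (1 / 2 * M * psi j t / r j))))); last first.
  by rewrite ler_pM2l //; exact: hB.
rewrite -grid_avgZ; apply: grid_avg_le => t _.
set b := 1 / 2 * M * psi j t / r j.
have -> : 1 / 2 * M * psi j t = r j * b by rewrite /b [RHS]mulrC divfK // gt_eqF.
rewrite -mulrBr mulrCA ler_pM2l //.
have -> : expR (- b) = expR (- A t) * expR (A t - b).
  by rewrite -expRD; congr expR; ring.
rewrite ler_pM2l ?expR_gt0 //; apply: le_trans (expR_ge1Dx _).
by rewrite addrA.
Qed.

Definition quad n d (a : 'I_n -> 'rV[R]_d) (t : 'rV[R]_d) : R :=
  \sum_k dot t (a k) ^+ 2.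

(** The hypothesis on [a], restricted from the ball of radius [sqrt d] to the inscribed cube
    [[-1, 1]^d], where all grid points lie. *)
Definition incoherent n d (a : 'I_n -> 'rV[R]_d) (alpha : R) : Prop :=
  forall (m : 'I_n -> int) (t : 'rV[R]_d),
    (exists k, 1 / 2 <= `|dot t (a k)|) -> (forall i, `|t 0 i| <= 1) ->
    alpha ^+ 2 <= \sum_k (dot t (a k) - (m k)%:~R) ^+ 2.

Lemma psi_lower n d (a : 'I_n -> 'rV[R]_d) (alpha z : R) (t : 'rV[R]_d) :
  incoherent a alpha -> `|z| <= 1 -> (forall i, `|t 0 i| <= 1) ->
  2 * (z ^+ 2 * quad a t) <= psi a z t \/ 2 * alpha ^+ 2 <= psi a z t.
Proof.
move=> inc z1 t1.
have [/forallP small|/forallPn[k0]] := boolP [forall k, `|z * dot t (a k)| < 1 / 2].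
  left; rewrite /quad !mulr_sumr; apply: ler_sum => k _.
  by rewrite -exprMn one_sub_cos_ge // ltW.
rewrite -leNgt => big; right.
(* Subtracting the nearest integer preserves the cosine and brings the argument into the range of
   [one_sub_cos_ge]. *)
pose m k := sval (cid (int_near (z * dot t (a k)))).
have mE k : `|z * dot t (a k) - (m k)%:~R| <= 1 / 2 by rewrite /m; case: cid.
apply: (@le_trans _ _ (2 * \sum_k (z * dot t (a k) - (m k)%:~R) ^+ 2)).
  rewrite ler_pM2l //; have := inc m (z *: t); under eq_bigr do rewrite dotZl.
  apply; first by exists k0; rewrite dotZl.
  by move=> i; rewrite mxE normrM mulr_ile1.
rewrite mulr_sumr; apply: ler_sum => k _.
by rewrite -(cos_addz _ (m k)) one_sub_cos_ge.
Qed.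

(** In the first alternative of [psi_lower] the factor [z ^+ 2] cancels; in the second, dividing by
    [z ^+ 2 <= 1] only helps. The sum of the two exponentials dominates either one. *)
Lemma grid_avg_small n d K (a : 'I_n -> 'rV[R]_d) (alpha z c : R) : (0 < K)%N ->
  incoherent a alpha -> 0 < `|z| -> `|z| <= 1 -> 0 <= c ->
  grid_avg K (fun t => expR (- (c * psi a z t / z ^+ 2))) <=
  grid_avg K (fun t => expR (- (2 * c * quad a t))) + expR (- (2 * c * alpha ^+ 2)).
Proof.
move=> K0 inc z0 z1 c0.
have zz : 0 < z ^+ 2 by rewrite -(real_normK (num_real z)) exprn_gt0.
have zz1 : z ^+ 2 <= 1 by rewrite -(real_normK (num_real z)) expr_le1.
rewrite -[X in _ + X](@grid_avg_const R d K) // -grid_avgD.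
apply: grid_avg_le => t t1.
have [h|h] := psi_lower inc z1 t1.
  apply: (@le_trans _ _ (expR (- (2 * c * quad a t)))); last by rewrite lerDl expR_ge0.
  rewrite ler_expR lerN2 ler_pdivlMr //.
  have -> : 2 * c * quad a t * z ^+ 2 = c * (2 * (z ^+ 2 * quad a t)) by ring.
  by rewrite ler_wpM2l.
apply: (@le_trans _ _ (expR (- (2 * c * alpha ^+ 2)))); last by rewrite lerDr expR_ge0.
rewrite ler_expR lerN2 ler_pdivlMr //.
have -> : 2 * c * alpha ^+ 2 * z ^+ 2 = c * (2 * alpha ^+ 2) * z ^+ 2 by ring.
have := sqr_ge0 alpha => al0.
apply: (@le_trans _ _ (c * (2 * alpha ^+ 2))); last by rewrite ler_wpM2l.
apply: ler_piMr => //; apply: mulr_ge0 => //; exact: mulr_ge0.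
Qed.

(** * The lazy random walk and removal of a large scale factor *)

Section LazyWalk.
Variables (n d : nat) (a : 'I_n -> 'rV[R]_d) (M : R).
Hypotheses (M0 : 0 <= M) (M1 : M <= 1).

Definition lazy_step (i : 'I_3) : R := (i : nat)%:R - 1.
(** Index 1 is the step 0. Mass [M / 8] on each of the steps -1 and 1 gives the factors
    [1 - M / 4 (1 - cos)], which are at least 1/2 for [0 <= M <= 1]. *)
Definition lazy_prob (i : 'I_3) : R := if i == 1 :> nat then 1 - M / 4 else M / 8.

Definition lazy_char (t : 'rV[R]_d) : R :=
  \prod_k (1 - M / 4 * (1 - cos (2 * pi * dot t (a k)))).

Lemma lazy_prob_ge0 i : 0 <= lazy_prob i.
Proof. by move: M0 M1; rewrite /lazy_prob => ? ?; case: ifP => _; lra. Qed.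

Lemma lazy_char_ge0 t : 0 <= lazy_char t.
Proof.
apply: prodr_ge0 => k _; set c := cos _.
have : -1 <= c <= 1 by rewrite cos_geN1 cos_le1.
move: M0 M1 => ? ?.
by move=> /andP[? ?]; nra.
Qed.

Lemma lazy_charE t :
  \sum_(f : {ffun 'I_n -> 'I_3}) real_complex R (wt lazy_prob f) *
    cis (2 * pi * dot t (lin_comb lazy_step a f)) = real_complex R (lazy_char t).
Proof.
rewrite char_prod /lazy_char rmorph_prod; apply: eq_bigr => k _.
rewrite !big_ord_recl big_ord0 /lazy_prob /lazy_step /=.
set th := 2 * pi * _.
have -> : (0%:R - 1) * th = - th by ring.
have -> : ((bump 0 0)%:R - 1) * th = 0 by rewrite /bump /= subrr mul0r.
have -> : ((bump 0 (bump 0 0))%:R - 1) * th = th by rewrite /bump /=; ring.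
rewrite /cis cosN sinN cos0 sin0.
by apply/eqP; rewrite eq_complex /=; apply/andP; split; apply/eqP; field.
Qed.

Lemma lazy_char_upper t : lazy_char t <= expR (- (M / 4 * psi a 1 t)).
Proof.
rewrite /psi mulr_sumr -sumrN expR_sum; apply: ler_prod => k _.
rewrite mul1r; set c := cos _.
have : -1 <= c <= 1 by rewrite cos_geN1 cos_le1.
move: M0 M1 => ? ?.
move=> /andP[? ?]; apply/andP; split; first by nra.
exact: expR_ge1Dx.
Qed.

Lemma lazy_char_lower (z : R) (t : 'rV[R]_d) : expR (- (1 / 2 * M * psi a z t)) <= lazy_char (z *: t).
Proof.
rewrite /psi mulr_sumr -sumrN expR_sum; apply: ler_prod => k _.
rewrite expR_ge0 /= dotZl; set c := cos _.
have : -1 <= c <= 1 by rewrite cos_geN1 cos_le1.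
move: M0 M1 => ? ?.
move=> /andP[c1 c2]; set y := 1 / 2 * M * (1 - c).
have y0 : 0 <= y by rewrite /y; nra.
have y1 : y <= 1 by rewrite /y; nra.
(* [exp (- y) <= 1 / (1 + y) <= 1 - y / 2] on [0, 1] *)
have -> : 1 - M / 4 * (1 - c) = 1 - y / 2 by rewrite /y; field.
rewrite expRN; apply: (@le_trans _ _ (1 + y)^-1).
  by rewrite lef_pV2 ?posrE ?expR_gt0 ?expR_ge1Dx //; lra.
rewrite -div1r ler_pdivrMr; last by lra.
nra.
Qed.

(** The left side is the mean of a product of Fejer kernels at [z *: s f], controlled through
    [decay] and [cover_sum] by the masses of cubes for [z *: s]. As [|z| >= 1], dividing by [z]
    shrinks a cube, so masses of cubes for [s] suffice, and [esseen_cube] leads back to the grid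
    average; nonnegativity of [lazy_char] removes the modulus. The bound by [K / 2] is the range of
    the decay estimate. *)
Lemma lazy_char_rescale K (z : R) : (0 < K)%N -> 1 <= `|z| ->
  (forall f i, `|z * lin_comb lazy_step a f 0 i| <= K%:R / 2) ->
  grid_avg K (fun t => lazy_char (z *: t)) <= (2 ^+ 8) ^+ d * grid_avg K lazy_char.
Proof.
move=> K0 z1 zK.
have z0 : z != 0 by rewrite -normr_gt0; lra.
pose q := wt (n := n) lazy_prob; pose s := lin_comb lazy_step a.
have q0 f : 0 <= q f by apply: prodr_ge0 => k _; exact: lazy_prob_ge0.
have -> : (fun t => lazy_char (z *: t)) =
    (fun t => \sum_f q f * cos (2 * pi * dot t (z *: s f))).
  apply/funext => t; have := congr1 (@complex.Re R) (lazy_charE (z *: t)).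
  rewrite Re_sum /= => <-; apply: eq_bigr => f _.
  by rewrite mul0r subr0 dotZl dotZr.
rewrite grid_avg_sum; under eq_bigr do rewrite grid_avg_cos.
have -> : (2 : R) ^+ 8 = (2 * 2 ^+ 6) * 2 by rewrite -exprS -exprSr.
rewrite exprMn -mulrA.
apply: (@cover_sum _ _ _ q (fun f => z *: s f) _ (@decay R)) => //.
- by move=> l; rewrite divr_ge0 // mulr_ge0 // addr_ge0.
- exact: sum_decay.
- move=> f; apply: ler_prod => i _; rewrite fejer_ge0 /=.
  by rewrite mxE fejer_le_decay.
- move=> y; apply: (@le_trans _ _ (\sum_(f | in_cube (fun i => y i / z) (s f)) q f)).
    rewrite [leLHS]big_mkcond [leRHS]big_mkcond; apply: ler_sum => f _.
    case: ifPn => [/forallP h|_]; last by case: ifP.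
    suff -> : in_cube (fun i => y i / z) (s f) by [].
    apply/forallP => i; have := h i; rewrite mxE.
    have -> : z * s f 0 i - y i = z * (s f 0 i - y i / z) by field.
    rewrite normrM; apply: le_trans; rewrite -[leLHS]mul1r ler_wpM2r //.
  apply: le_trans (esseen_cube s _ K0 q0) _; rewrite ler_pM2l ?exprn_gt0 //.
  apply: grid_avg_le => t _; rewrite lazy_charE /= expr0n /= addr0.
  by rewrite sqrtr_sqr ger0_norm // lazy_char_ge0.
Qed.

End LazyWalk.

End CharacteristicFunctions.

(** * One-dimensional Gaussian sums *)

Section GaussianSums.
Variable R : realType.

Definition squash (y : R) := y / (1 + `|y|).

(* [squash] increases by at least [l / (2 * (1 + |y|) ^+ 2)] between [y] and
   [y + l], so Gaussian sums are dominated by telescoping ones. *)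
Lemma gauss_le_squash (l y : R) : 0 < l -> l <= 1 ->
  l * expR (- y ^+ 2) <= 4 * (squash (y + l) - squash y).
Proof.
move=> l0 l1; set s := 1 + `|y|.
have s1 : 1 <= s by rewrite lerDl.
have s0 : 0 < s by lra.
(* This combines [exp (- y^2) <= 1 / (1 + y^2)] with [(1 + |y|)^2 <= 2 (1 + y^2)]. *)
have expE : expR (- y ^+ 2) <= 2 / s ^+ 2.
  rewrite expRN -[leRHS]invrK lef_pV2 ?posrE ?expR_gt0 ?invr_gt0 ?divr_gt0 ?exprn_gt0 //.
  rewrite invf_div; apply: le_trans (expR_ge1Dx _).
  have := sqr_ge0 (1 - `|y|); rewrite -(real_normK (num_real y)) /s !expr2; lra.
have : l / (2 * s ^+ 2) <= squash (y + l) - squash y.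
  rewrite /squash -/s.
  have [y0|y0] := leP 0 y.
    have sE : y = s - 1 by rewrite /s ger0_norm //; lra.
    rewrite [`|y + l|]ger0_norm; last by lra.
    have -> : (y + l) / (1 + (y + l)) - y / s = l / (s * (s + l)).
      by rewrite sE; field; apply/andP; split; apply/lt0r_neq0; lra.
    rewrite ler_pM2l // lef_pV2 ?posrE; last 2 first.
    - by rewrite mulr_gt0 // exprn_gt0.
    - by rewrite mulr_gt0 //; lra.
    by rewrite expr2; nra.
  have sE : y = 1 - s by rewrite /s ltr0_norm //; lra.
  have [yl|yl] := leP 0 (y + l).
    (* The step crosses 0: its two sides contribute [1 - 1 / u] and [1 - 1 / s] with [u] and [s] in
       [[1, 2]], and [(u - 1) + (s - 1) = l]. *)
    rewrite ger0_norm //.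
    have -> : (y + l) / (1 + (y + l)) - y / s = (1 - (1 + (y + l))^-1) + (1 - s^-1).
      by rewrite sE; field; apply/andP; split; apply/lt0r_neq0; lra.
    set u := 1 + (y + l); have u1 : 1 <= u by rewrite /u; lra.
    have u2 : u <= 2 by rewrite /u; lra.
    have hu : (u - 1) / 2 <= 1 - u^-1.
      rewrite -[1 - u^-1](_ : (u - 1) / u = _); last by field; apply/lt0r_neq0; lra.
      by rewrite ler_wpM2l ?lef_pV2 ?posrE; lra.
    have hs : (s - 1) / 2 <= 1 - s^-1.
      rewrite -[1 - s^-1](_ : (s - 1) / s = _); last by field; apply/lt0r_neq0; lra.
      by rewrite ler_wpM2l ?lef_pV2 ?posrE; lra.
    have hl : l / (2 * s ^+ 2) <= l / 2.
      rewrite ler_pM2l // lef_pV2 ?posrE ?mulr_gt0 ?exprn_gt0 //.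
      by rewrite expr2; nra.
    by move: hu hs hl; rewrite /u sE; lra.
  rewrite ltr0_norm //.
  have -> : (y + l) / (1 - (y + l)) - y / s = l / (s * (s - l)).
    by rewrite sE; field; apply/andP; split; apply/lt0r_neq0; lra.
  have sl : 0 < s - l by lra.
  rewrite ler_pM2l // lef_pV2 ?posrE ?mulr_gt0 ?exprn_gt0 //.
  by rewrite expr2; nra.
have -> : l / (2 * s ^+ 2) = l * (2 / s ^+ 2) / 4 by field; rewrite gt_eqF.
move=> h; have : l * expR (- y ^+ 2) <= l * (2 / s ^+ 2) by rewrite ler_pM2l.
lra.
Qed.

(** The bounds telescope, and [squash] takes values in [[-1, 1]], whence 4 times 2. *)
Lemma gauss_sum_step (l w : R) K : 0 < l -> l <= 1 ->
  \sum_(j < K) l * expR (- (l * j%:R - w) ^+ 2) <= 8.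
Proof.
move=> l0 l1.
apply: (@le_trans _ _ (4 * (squash (l * K%:R - w) - squash (l * 0%:R - w)))).
  elim: K => [|K IH]; first by rewrite big_ord0 subrr mulr0.
  rewrite big_ord_recr /=; have := gauss_le_squash (l * K%:R - w) l0 l1.
  have -> : l * K%:R - w + l = l * K.+1%:R - w by rewrite -natr1; ring.
  by move: IH; lra.
have sq1 y : -1 <= squash y <= 1.
  rewrite -ler_norml /squash normrM normfV (ger0_norm (_ : 0 <= 1 + `|y|)) //.
  by rewrite ler_pdivrMr ?mul1r ?lerDr // ltr_wpDr.
have /andP[? ?] := sq1 (l * K%:R - w); have /andP[? ?] := sq1 (l * 0%:R - w).
lra.
Qed.

(** Rescaling by [sqrt c] gives the mesh [sqrt c / K <= 1]; the bound is uniform in the shift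
    [w]. *)
Lemma gauss_sum1 (c w : R) K : 0 < c -> Num.sqrt c <= K%:R ->
  \sum_(j < K) expR (- (c * (j%:R / K%:R - w) ^+ 2)) <= 8 / Num.sqrt c * K%:R.
Proof.
move=> c0 cK; have s0 : 0 < Num.sqrt c by rewrite sqrtr_gt0.
have K0 : 0 < (K%:R : R) by lra.
pose l := Num.sqrt c / K%:R.
have l0 : 0 < l by rewrite divr_gt0.
have l1 : l <= 1 by rewrite ler_pdivrMr // mul1r.
have := @gauss_sum_step l (Num.sqrt c * w) K l0 l1; rewrite -mulr_sumr.
have -> : 8 / Num.sqrt c * K%:R = 8 / l.
  by rewrite /l; field; apply/andP; split; apply/lt0r_neq0.
rewrite ler_pdivlMr // mulrC; apply: le_trans; apply/eqW; congr (_ * _).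
apply: eq_bigr => j _; congr (expR (- _)).
rewrite -{1}(sqr_sqrtr (ltW c0)) -exprMn; congr (_ ^+ 2).
by rewrite /l; ring.
Qed.

(** * Quadratic forms, Schur complements and Gaussian sums in several dimensions *)

Definition form d (N : 'M[R]_d) (x : 'rV[R]_d) : R := (x *m N *m x^T) 0 0.

Section Schur.
Variables (d : nat) (n : R) (B : 'rV[R]_d) (D : 'M[R]_d).
Hypothesis n0 : n != 0.

Let N : 'M[R]_(1 + d) := block_mx n%:M B B^T D.
Definition schur : 'M[R]_d := D - n^-1 *: (B^T *m B).

(** Completing the square in the first coordinate. *)
Lemma form_schur (x : R) (y : 'rV[R]_d) :
  form N (row_mx x%:M y) = n * (x + (y *m B^T) 0 0 / n) ^+ 2 + form schur y.
Proof.
rewrite /form /N /schur tr_row_mx mul_row_block mul_row_col tr_scalar_mx.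
rewrite mulmxBr mulmxBl -scalemxAr -scalemxAl -scalar_mxM.
have E : y *m B^T = ((y *m B^T) 0 0)%:M by exact: mx11_scalar.
set b := (y *m B^T) 0 0 in E *.
have E2 : B *m y^T = b%:M by rewrite -[B *m y^T]trmxK trmx_mul trmxK E tr_scalar_mx.
have E3 : y *m (B^T *m B) *m y^T = (b * b)%:M.
  by rewrite mulmxA E mul_scalar_mx -scalemxAl E2 scale_scalar_mx.
rewrite E3 E -raddfD -scalar_mxM mulmxDl mul_scalar_mx -scalemxAl E2.
by rewrite !mxE eqxx !mulr1n; field.
Qed.

Lemma det_schur : \det N = n * \det schur.
Proof.
have -> : N = block_mx 1%:M 0 (n^-1 *: B^T) 1%:M *m block_mx n%:M B 0 schur.
  rewrite mulmx_block !(mul1mx, mul0mx, mulmx0, addr0) /schur.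
  rewrite -scalemxAl mul_mx_scalar scalerA mulVf // scale1r.
  by rewrite -scalemxAl addrC subrK.
by rewrite det_mulmx det_lblock det_ublock !det1 !mul1r det_scalar1.
Qed.

End Schur.

Definition posdef d (N : 'M[R]_d) := forall x : 'rV[R]_d, x != 0 -> 0 < form N x.

Definition to_grid d K (j : 'rV['I_K]_d) : 'rV[R]_d :=
  map_mx (fun i : 'I_K => (i : nat)%:R / K%:R) j.

(** Induction on the dimension, peeling off the first coordinate. Completing the square moves its
    centre by an amount depending on the other coordinates, which is harmless since [gauss_sum1] is
    uniform in the shift. The others carry the Schur complement, and [\det N = n * \det S] matches
    the product of the two bounds. *)
Lemma gauss_sum d (N : 'M[R]_d) : N^T = N -> posdef N ->
  0 < \det N /\
  exists K0, forall K, (K0 <= K)%N -> (0 < K)%N -> forall v : 'rV[R]_d,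
    \sum_(j : 'rV['I_K]_d) expR (- form N (to_grid j - v)) <=
    8 ^+ d / Num.sqrt (\det N) * K%:R ^+ d.
Proof.
elim: d N => [|d IH] N.
  move=> _ _; rewrite det_mx00; split=> //; exists 0%N => K _ _ v.
  rewrite sqrtr1 !expr0 divr1 mulr1.
  apply: (@le_trans _ _ (\sum_(j : 'rV['I_K]_0) 1)).
    apply: ler_sum => j _; rewrite /form (thinmx0 (to_grid j - v)) !mul0mx mxE.
    by rewrite oppr0 expR0.
  by rewrite sumr_const card_mx mul1n expn0.
rewrite -[d.+1]/(1 + d)%N in N *.
move=> symN posN.
pose n := N 0 0; pose B : 'rV[R]_d := ursubmx N; pose D := drsubmx N.
have NE : N = block_mx n%:M B B^T D.
  rewrite -[LHS]submxK /B trmx_ursub symN; congr block_mx.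
  by rewrite [LHS]mx11_scalar !mxE; congr (N _ _)%:M; apply/val_inj.
have n_gt0 : 0 < n.
  have := posN (row_mx 1%:M 0); rewrite {1}/form NE tr_row_mx mul_row_block.
  rewrite !mul1mx !mul0mx !addr0 mul_row_col trmx0 mulmx0 addr0 trmx1 mulmx1.
  rewrite mxE eqxx mulr1n; apply; apply/eqP => /matrixP/(_ 0 (lshift d 0)).
  by rewrite row_mxEl !mxE eqxx => /eqP; rewrite oner_eq0.
have n0 : n != 0 by rewrite gt_eqF.
pose S := schur n B D.
have symD : D^T = D by rewrite /D trmx_drsub symN.
have symS : S^T = S.
  by rewrite /S /schur linearB linearZ /= symD trmx_mul trmxK.
have posS : posdef S.
  move=> y y0; pose b := (y *m B^T) 0 0.
  (* This first coordinate makes the square vanish and leaves the form of [S] at [y]. *)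
  have : 0 < form N (row_mx (- (b / n))%:M y).
    apply: posN; apply: contra y0 => /eqP/(congr1 rsubmx).
    by rewrite row_mxKr linear0 => ->.
  by rewrite NE form_schur // -/b addNr expr0n /= mulr0 add0r.
have [detS [K1 hK1]] := IH S symS posS.
have detN : \det N = n * \det S by rewrite NE det_schur.
rewrite detN; split; first by rewrite mulr_gt0.
(* The second threshold ensures [sqrt n <= K], as [gauss_sum1] requires. *)
exists (maxn K1 (Num.truncn (Num.sqrt n)).+1) => K; rewrite geq_max => /andP[KK1 Kn] K0 v.
have nK : Num.sqrt n <= K%:R.
  have /andP[_ h] := truncn_itv (sqrtr_ge0 n).
  by apply: le_trans (ltW h) _; rewrite ler_nat.
pose h (p : 'I_K * 'rV['I_K]_d) : 'rV['I_K]_(1 + d) := row_mx (const_mx p.1) p.2.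
have hbij : bijective h.
  exists (fun j => (lsubmx j 0 0, rsubmx j)) => [[i j]|j]; rewrite /h /=.
    by rewrite row_mxKl row_mxKr mxE.
  rewrite -[RHS]hsubmxK; congr row_mx; apply/matrixP => a b.
  by rewrite !ord1 !mxE.
rewrite (reindex h) /=; last exact: onW_bij.
pose v0 := lsubmx v 0 0; pose v' := rsubmx v.
pose b (j : 'rV['I_K]_d) := ((to_grid j - v') *m B^T) 0 0.
have hE p : expR (- form N (to_grid (h p) - v)) =
    expR (- (n * (p.1%:R / K%:R - (v0 - b p.2 / n)) ^+ 2)) *
    expR (- form S (to_grid p.2 - v')).
  rewrite -expRD -opprD -{1}(hsubmxK v) /to_grid /h map_row_mx opp_row_mx.
  rewrite add_row_mx NE.
  have -> : map_mx (fun i : 'I_K => (i : nat)%:R / K%:R : R) (const_mx p.1) - lsubmx v =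
      (p.1%:R / K%:R - v0)%:M :> 'M[R]_1.
    by rewrite [LHS]mx11_scalar /v0 !mxE.
  rewrite form_schur // -/v' -/(to_grid p.2) -/(b p.2).
  by have -> : p.1%:R / K%:R - v0 + b p.2 / n =
    p.1%:R / K%:R - (v0 - b p.2 / n) by ring.
under eq_bigr do rewrite hE.
rewrite -(pair_bigA _ (fun (i : 'I_K) (j : 'rV['I_K]_d) =>
  expR (- (n * (i%:R / K%:R - (v0 - b j / n)) ^+ 2)) *
  expR (- form S (to_grid j - v')))) exchange_big /=.
apply: (@le_trans _ _ (\sum_(j : 'rV['I_K]_d)
    (8 / Num.sqrt n * K%:R) * expR (- form S (to_grid j - v')))).
  apply: ler_sum => j _; rewrite -mulr_suml ler_wpM2r ?expR_ge0 //.
  exact: gauss_sum1.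
rewrite -mulr_sumr.
apply: (@le_trans _ _ (8 / Num.sqrt n * K%:R *
    (8 ^+ d / Num.sqrt (\det S) * K%:R ^+ d))).
  rewrite ler_wpM2l ?hK1 // mulr_ge0 // divr_ge0 // sqrtr_ge0 //.
rewrite sqrtrM ?(ltW n_gt0) // -[(1 + d)%N]/(d.+1) !exprS invfM.
by apply/eqW; ring.
Qed.

(** For a fixed second grid point, the sum over the first is a Gaussian sum shifted by that
    point. *)
Lemma grid_avg_gauss d (N : 'M[R]_d) : N^T = N -> posdef N ->
  exists K0, forall K, (K0 <= K)%N -> (0 < K)%N ->
    grid_avg K (fun t => expR (- form N t)) <= 8 ^+ d / Num.sqrt (\det N).
Proof.
move=> symN posN; have [detN [K0 hK]] := gauss_sum symN posN.
exists K0 => K KK0 Kpos; rewrite /grid_avg.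
have Kd : 0 < (K%:R : R) ^+ d by rewrite exprn_gt0 // ltr0n.
rewrite ler_pdivrMr ?exprn_gt0 ?ltr0n //.
rewrite [leLHS]exchange_big /=.
pose C := 8 ^+ d / Num.sqrt (\det N) * K%:R ^+ d.
apply: (@le_trans _ _ (\sum_(j' : {ffun 'I_d -> 'I_K}) C)).
  apply: ler_sum => j' _; pose v : 'rV['I_K]_d := \row_i j' i.
  apply: le_trans (hK K KK0 Kpos (to_grid v)).
  pose h (m : 'rV['I_K]_d) : {ffun 'I_d -> 'I_K} := [ffun i => m 0 i].
  have hbij : bijective h.
    exists (fun f : {ffun 'I_d -> 'I_K} => \row_i f i) => [m|f]; rewrite /h.
      by apply/rowP => i; rewrite mxE ffunE.
    by apply/ffunP => i; rewrite ffunE mxE.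
  rewrite (reindex h) /=; last exact: onW_bij.
  apply: ler_sum => m _; apply/eqW; congr (expR (- form N _)).
  by apply/rowP => i; rewrite !mxE ffunE mulrBl.
rewrite sumr_const card_ffun !card_ord /C -[_ *+ (_ ^ _)%N]mulr_natr natrX.
by apply/eqW; ring.
Qed.

(** * The Gram matrix of the coefficient vectors *)

Definition gram n d (a : 'I_n -> 'rV[R]_d) : 'M[R]_d := \sum_k (a k)^T *m a k.

Lemma form_gram n d (a : 'I_n -> 'rV[R]_d) (t : 'rV[R]_d) :
  form (gram a) t = quad a t.
Proof.
rewrite /form /gram /quad mulmx_sumr mulmx_suml summxE; apply: eq_bigr => k _.
have tk : t *m (a k)^T = (dot t (a k))%:M.
  rewrite [LHS]mx11_scalar; congr _%:M; rewrite mxE; apply: eq_bigr => i _.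
  by rewrite mxE.
have kt : a k *m t^T = (dot t (a k))%:M.
  by rewrite -[LHS]trmxK trmx_mul trmxK tk tr_scalar_mx.
by rewrite mulmxA tk -mulmxA kt -scalar_mxM mxE eqxx mulr1n expr2.
Qed.

Lemma quad_ge0 n d (a : 'I_n -> 'rV[R]_d) (t : 'rV[R]_d) : 0 <= quad a t.
Proof. by apply: sumr_ge0 => k _; exact: sqr_ge0. Qed.

Lemma trmx_gram n d (a : 'I_n -> 'rV[R]_d) : (gram a)^T = gram a.
Proof.
by rewrite /gram linear_sum; apply: eq_bigr => k _ /=; rewrite trmx_mul trmxK.
Qed.

(** If the form vanishes at [t], then [t] is orthogonal to every [a k], so [t *m gram a = 0] and
    invertibility gives [t = 0]. *)
Lemma posdef_gram n d (a : 'I_n -> 'rV[R]_d) : \det (gram a) != 0 -> posdef (gram a).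
Proof.
move=> dN t t0; rewrite form_gram lt_neqAle quad_ge0 andbT eq_sym.
apply: contra t0 => /eqP /psumr_eq0P q0.
have dot0 k : dot t (a k) = 0.
  apply/eqP; rewrite -sqrf_eq0; apply/eqP/q0 => // i _; exact: sqr_ge0.
have tN : t *m gram a = 0.
  rewrite /gram mulmx_sumr big1 // => k _; rewrite mulmxA.
  suff -> : t *m (a k)^T = 0 by rewrite mul0mx.
  rewrite [LHS]mx11_scalar -[RHS](raddf0 (@scalar_mx R 1)); congr _%:M.
  rewrite -[RHS](dot0 k) mxE; apply: eq_bigr => i _; by rewrite mxE.
have uN : gram a \in unitmx by rewrite unitmxE unitfE.
by rewrite -(mulmxK uN t) tN mul0mx.
Qed.

Lemma det_gram_gt0 n d (a : 'I_n -> 'rV[R]_d) :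
  \det (gram a) != 0 -> 0 < \det (gram a).
Proof. by move=> h; have [] := gauss_sum (trmx_gram a) (posdef_gram h). Qed.

Lemma grid_avg_quad n d (a : 'I_n -> 'rV[R]_d) (M : R) :
  \det (gram a) != 0 -> 0 < M ->
  exists K0, forall K, (K0 <= K)%N -> (0 < K)%N ->
    grid_avg K (fun t => expR (- (M * quad a t))) <=
    8 ^+ d * ((1 / Num.sqrt M) ^+ d / Num.sqrt (\det (gram a))).
Proof.
move=> dN M0.
have fE t : form (M *: gram a) t = M * quad a t.
  by rewrite -form_gram /form -scalemxAr -scalemxAl mxE.
have [||K0 hK] := @grid_avg_gauss d (M *: gram a).
- by rewrite linearZ /= trmx_gram.
- by move=> t t0; rewrite fE -form_gram mulr_gt0 // posdef_gram.
exists K0 => K KK0 Kpos; have := hK K KK0 Kpos.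
under [X in grid_avg K X]eq_fun do rewrite fE.
move/le_trans; apply; apply/eqW.
rewrite detZ sqrtrM ?exprn_ge0 ?(ltW M0) //.
have -> : Num.sqrt (M ^+ d) = Num.sqrt M ^+ d.
  elim: d {a dN fE hK} => [|d IH]; first by rewrite !expr0 sqrtr1.
  by rewrite !exprS sqrtrM ?(ltW M0) // IH.
by rewrite div1r exprVn invfM mulrA.
Qed.

End GaussianSums.

(** * The concentration bound for finitely supported laws *)

Section FiniteLaw.
Variable R : realType.

Lemma ler_sum_term (I : finType) (F : I -> R) i :
  (forall j, 0 <= F j) -> F i <= \sum_j F j.
Proof. by move=> F0; rewrite (bigD1 i) //= lerDl sumr_ge0. Qed.

(** Passing to a moment at least [M / 2] costs [sqrt 2] per dimension, rounded up to 2. *)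
Lemma inv_sqrt_pow_le (M M' : R) d : 0 < M -> M <= 2 * M' ->
  (1 / Num.sqrt M') ^+ d <= 2 ^+ d * (1 / Num.sqrt M) ^+ d.
Proof.
move=> M0 MM'; rewrite -exprMn.
rewrite lerXn2r ?nnegrE ?mulr_ge0 ?divr_ge0 ?sqrtr_ge0 //.
have sM : 0 < Num.sqrt M by rewrite sqrtr_gt0.
have sM' : 0 < Num.sqrt M' by rewrite sqrtr_gt0; lra.
have -> : 2 * (1 / Num.sqrt M) = 1 / (Num.sqrt M / 2) by field; rewrite gt_eqF.
rewrite !div1r lef_pV2 ?posrE ?divr_gt0 //.
have -> : Num.sqrt M / 2 = Num.sqrt (M / 4).
  rewrite sqrtrM ?(ltW M0) //; congr (_ * _).
  have -> : (4^-1 : R) = (2^-1) ^+ 2 by field.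
  by rewrite sqrtr_sqr ger0_norm.
by rewrite ler_wsqrtr //; lra.
Qed.

(** The squared radius [4 d] leaves room for discretization. The factor [2^11] comes from
    [esseen_ball], [2^8] from removing a scale [|z| >= 1], and [2^4 = 8 * 2] from the Gaussian sum
    and from its rate [M / 2] in place of [M]. *)
Lemma concentration_finite n d (I : finType) (p x : I -> R)
    (a : 'I_n -> 'rV[R]_d) (alpha M : R) (y : 'rV[R]_d) :
  M = \sum_(ij : I * I)
    p ij.1 * p ij.2 * Num.min ((x ij.1 - x ij.2) ^+ 2) 1 ->
  (forall i, 0 <= p i) -> \sum_i p i = 1 -> 0 < M ->
  \det (gram a) != 0 -> incoherent a alpha ->
  \sum_(f | dot (lin_comb x a f - y) (lin_comb x a f - y) <= 4 * d%:R) wt p f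
   <= (2 ^+ 11 * (2 ^+ 8 * 2 ^+ 4)) ^+ d * ((1 / Num.sqrt M) ^+ d / Num.sqrt (\det (gram a))
                      + expR (- (1 / 2 * alpha ^+ 2 * M))).
Proof.
move=> ME p0 p1 M0 dN inc.
pose w (ij : I * I) := p ij.1 * p ij.2.
pose z (ij : I * I) := x ij.1 - x ij.2.
pose r (ij : I * I) := Num.min (z ij ^+ 2) 1.
have w0 ij : 0 <= w ij by exact: mulr_ge0.
have r0 ij : 0 <= r ij by rewrite le_min sqr_ge0 ler01.
have w1 : \sum_ij w ij = 1.
  rewrite -(pair_bigA _ (fun i j => p i * p j)) /=.
  under eq_bigr do rewrite -mulr_sumr p1 mulr1.
  by rewrite p1.
have M1 : M <= 1.
  rewrite ME -[leRHS]w1; apply: ler_sum => ij _.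
  by apply: ler_piMr; [exact: w0 | rewrite ge_min lexx orbT].
have M20 : 0 < M / 2 by lra.
have [K0 hK0] := grid_avg_quad dN M20.
(* [Z] dominates all coordinates of all rescaled walks, so [K > 2 Z] puts them in the range of
   [lazy_char_rescale]. *)
pose Z := \sum_ij \sum_(f : {ffun 'I_n -> 'I_3}) \sum_i
  `|z ij * lin_comb (@lazy_step R) a f 0 i|.
pose K := maxn K0 (Num.truncn (2 * Z)).+1.
have Kpos : (0 < K)%N by rewrite /K leq_max orbT.
have Z0 : 0 <= 2 * Z.
  by rewrite mulr_ge0 // !sumr_ge0 // => ? _; rewrite !sumr_ge0 // => ? _; rewrite sumr_ge0.
have zK ij (f : {ffun 'I_n -> 'I_3}) i :
    `|z ij * lin_comb (@lazy_step R) a f 0 i| <= K%:R / 2.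
  have ZK : 2 * Z <= K%:R.
    have /andP[_ h] := truncn_itv Z0; apply: le_trans (ltW h) _.
    by rewrite ler_nat leq_maxr.
  suff : `|z ij * lin_comb (@lazy_step R) a f 0 i| <= Z by lra.
  apply: le_trans (ler_sum_term ij _) => /=; last first.
    by move=> ?; rewrite !sumr_ge0 // => ? _; rewrite sumr_ge0.
  apply: le_trans (ler_sum_term f _) => /=; last by move=> ?; rewrite sumr_ge0.
  by apply: le_trans (ler_sum_term i _) => /=.
(* The rate [M / 2] is what the lazy walk yields; differences with [|z| < 1] yield the better rate
   [M]. *)
pose G := grid_avg K (fun t => expR (- (M / 2 * quad a t))).
pose E := expR (- (1 / 2 * alpha ^+ 2 * M)).
have G0 : 0 <= G by apply: grid_avg_ge0 => t; exact: expR_ge0.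
have E0 : 0 <= E by exact: expR_ge0.
have GE0 : 0 <= G + E by exact: addr_ge0.
have al0 := sqr_ge0 alpha.
have layer ij : 0 < r ij ->
    grid_avg K (fun t => expR (- (1 / 2 * M * psi a (z ij) t / r ij))) <=
    (2 ^+ 8) ^+ d * (G + E).
  move=> rp; have [z1|z1] := ltP `|z ij| 1.
    have zp : 0 < `|z ij|.
      rewrite normr_gt0; apply: contraTneq rp => z00.
      by rewrite /r z00 expr0n /= min_l ?ltxx.
    have -> : r ij = z ij ^+ 2.
      by rewrite /r min_l // -(real_normK (num_real _)) expr_le1 // ltW.
    have c0 : 0 <= 1 / 2 * M by lra.
    apply: le_trans (grid_avg_small Kpos inc zp (ltW z1) c0) _.
    apply: (@le_trans _ _ (G + E)); last by rewrite ler_peMl // !exprn_ege1 // ler1n.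
    apply: lerD.
      apply: grid_avg_le => t _; rewrite ler_expR lerN2.
      have := quad_ge0 a t; nra.
    rewrite ler_expR lerN2; nra.
  have -> : r ij = 1.
    by rewrite /r min_r // -(real_normK (num_real _)) exprn_ege1.
  apply: (@le_trans _ _ (grid_avg K (fun t => lazy_char a M (z ij *: t)))).
    apply: grid_avg_le => t _; rewrite divr1.
    by apply: lazy_char_lower => //; exact: ltW.
  apply: le_trans (lazy_char_rescale (ltW M0) M1 Kpos z1 (zK ij)) _.
  rewrite ler_pM2l ?exprn_gt0 //.
  have c0 : 0 <= M / 4 by lra.
  have one1 : 0 < `|1 : R| by rewrite normr1.
  have one2 : `|1 : R| <= 1 by rewrite normr1.
  apply: le_trans (le_trans (grid_avg_small Kpos inc one1 one2 c0) _).
    apply: grid_avg_le => t _; rewrite expr1n divr1.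
    by apply: lazy_char_upper => //; exact: ltW.
  apply: lerD.
    by apply: grid_avg_le => t _; rewrite ler_expR lerN2; apply/eqW; field.
  by rewrite ler_expR lerN2; apply/eqW; field.
have wt0 (f : {ffun 'I_n -> I}) : 0 <= wt p f by apply: prodr_ge0.
apply: le_trans (esseen_ball (lin_comb x a) y Kpos wt0) _.
set T1 := _ / Num.sqrt _.
have -> : (2 ^+ 11 * (2 ^+ 8 * 2 ^+ 4)) ^+ d * (T1 + E) =
    (2 ^+ 11) ^+ d * ((2 ^+ 8) ^+ d * ((2 ^+ 4) ^+ d * (T1 + E))) by rewrite !exprMn !mulrA.
rewrite ler_pM2l ?exprn_gt0 //.
apply: (@le_trans _ _ ((2 ^+ 8) ^+ d * (G + E))).
  apply: (le_trans _ (@grid_avg_jensen R d K _ w r (fun ij => psi a (z ij)) M _ w0 r0 _ ME M0 layer)).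
    apply: grid_avg_le => t _; exact: normc_char_prod_le.
  move=> ij rij t; suff z00 : z ij = 0.
    by rewrite /psi big1 // => k _; rewrite z00 mul0r mulr0 cos0 subrr.
  apply/eqP; rewrite -sqrf_eq0; move: rij; rewrite /r /Num.min.
  by case: ifP => [_ ->//|_ /eqP]; rewrite oner_eq0.
rewrite ler_pM2l ?exprn_gt0 // mulrDr lerD //.
  apply: le_trans (hK0 K (leq_maxl _ _) Kpos) _.
  have sD : 0 <= (Num.sqrt (\det (gram a)))^-1 by rewrite invr_ge0 sqrtr_ge0.
  rewrite /T1 mulrA [leRHS]mulrA ler_wpM2r //.
  have -> : (2 : R) ^+ 4 = 8 * 2 by rewrite !exprS expr0; lra.
  rewrite [(8 * 2) ^+ d]exprMn -[leRHS]mulrA ler_pM2l ?exprn_gt0 //.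
  by apply: inv_sqrt_pow_le => //; lra.
by rewrite ler_peMl // !exprn_ege1 // ler1n.
Qed.

End FiniteLaw.

(** * Integrals of functions of a finite-valued map *)

Section Discretization.
Context (dT : measure_display) (T : measurableType dT) (mu : probability T RR).
Variables (J : finType) (q : T -> J).
Hypothesis mq : forall j, measurable (q @^-1` [set j]).

Definition cell_prob (j : J) : RR := fine (mu (q @^-1` [set j])).

Lemma cell_prob_ge0 j : 0 <= cell_prob j.
Proof. by rewrite /cell_prob fine_ge0. Qed.

Lemma cell_probE j : mu (q @^-1` [set j]) = (cell_prob j)%:E.
Proof. by rewrite /cell_prob fineK // fin_num_measure. Qed.

Lemma stepE (h : J -> RR) :
  (fun x : T => (h (q x))%:E) =
  (fun x => \sum_j (h j)%:E * (\1_(q @^-1` [set j]) x)%:E)%E.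
Proof.
apply/funext => x; rewrite (bigD1 (q x)) //= big1 ?adde0.
  by rewrite indicE mem_set // mule1.
by move=> j jq; rewrite indicE memNset ?mule0 // => /= qj; rewrite qj eqxx in jq.
Qed.

Lemma measurable_step (h : J -> RR) : 
  measurable_fun setT (fun x : T => (h (q x))%:E).
Proof.
rewrite stepE; apply: emeasurable_sum => j.
apply: measurable_funeM; apply/measurable_EFinP.
exact: measurable_indic.
Qed.

Lemma integral_step (h : J -> RR) : (forall j, 0 <= h j) ->
  (\int[mu]_x (h (q x))%:E = (\sum_j cell_prob j * h j)%:E)%E.
Proof.
move=> h0; rewrite stepE ge0_integral_sum //=; first last.
- by move=> j x _; rewrite mule_ge0 // lee_fin.
- move=> j; apply: measurable_funeM; apply/measurable_EFinP.
  exact: measurable_indic.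
rewrite -sumEFin; apply: eq_bigr => j _.
rewrite ge0_integralZl_EFin //; last first.
  by apply/measurable_EFinP; exact: measurable_indic.
have -> : (\int[mu]_x (\1_(q @^-1` [set j]) x)%:E = (cell_prob j)%:E)%E.
  by rewrite integral_indic // setIT; exact: cell_probE.
by rewrite -EFinM mulrC.
Qed.

Lemma sum_cell_prob : \sum_j cell_prob j = 1.
Proof.
apply: EFin_inj; have := @integral_step (fun=> 1) (fun=> ler01).
under [in X in _ = X -> _]eq_bigr do rewrite mulr1.
move=> <-; rewrite integral_cst // mul1e; exact: probability_setT.
Qed.

End Discretization.

(** * The truncated second moment and its finite majorants *)

Section TruncatedSecondMoment.
Variables (mu : probability RR RR) (J : finType) (q : RR -> J).
Hypothesis mq : forall j, measurable (q @^-1` [set j]).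
Local Notation cell_prob := (cell_prob mu q).

(** The division by [1 ^+ 2] keeps this syntactically equal to the integrand of [Mfun mu 1]. *)
Definition trunc_sqr (u : RR * RR) : RR := Order.min ((u.1 - u.2) ^+ 2 / 1 ^+ 2) 1.

Lemma measurable_trunc_sqr : measurable_fun setT (fun u : RR * RR => (trunc_sqr u)%:E).
Proof.
apply/measurable_EFinP; apply: measurable_minr => //.
apply: measurable_funM => //; apply: measurable_funX.
by apply: measurable_funB; [exact: measurable_fst | exact: measurable_snd].
Qed.

Lemma trunc_sqr_ge0 u : 0 <= trunc_sqr u.
Proof. by rewrite /trunc_sqr le_min ler01 andbT divr_ge0 ?sqr_ge0. Qed.

(** A majorant that is constant on cells turns the iterated integral into a finite double sum. *)
Lemma Mfun_le (h : J -> J -> RR) : (forall i j, 0 <= h i j) ->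
  (forall x y, trunc_sqr (x, y) <= h (q x) (q y)) ->
  Mfun mu 1 <= \sum_(ij : J * J) cell_prob ij.1 * cell_prob ij.2 * h ij.1 ij.2.
Proof.
move=> h0 gh; pose H i := \sum_j cell_prob j * h i j.
have H0 i : 0 <= H i by apply: sumr_ge0 => j _; rewrite mulr_ge0 ?cell_prob_ge0.
have le1 : (\int[mu]_x \int[mu]_y (trunc_sqr (x, y))%:E <=
    (\sum_i cell_prob i * H i)%:E)%E.
  rewrite -integral_step //; apply: ge0_le_integral => //.
  - by move=> x _; apply: integral_ge0 => y _; rewrite lee_fin trunc_sqr_ge0.
  - have ge0 u : (0 <= (trunc_sqr u)%:E)%E by rewrite lee_fin trunc_sqr_ge0.
    apply: (@measurable_fun_fubini_tonelli_F _ _ RR RR RR mu _ _ ge0).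
    exact: measurable_trunc_sqr.
  - exact: measurable_step.
  move=> x _; rewrite -integral_step //; apply: ge0_le_integral => //.
  - by move=> y _; rewrite lee_fin trunc_sqr_ge0.
  - exact: (measurableT_comp measurable_trunc_sqr (measurable_pair1 x)).
  - exact: measurable_step.
  - by move=> y _; rewrite lee_fin.
have ge0 : (0 <= \int[mu]_x \int[mu]_y (trunc_sqr (x, y))%:E)%E.
  apply: integral_ge0 => x _; apply: integral_ge0 => y _.
  by rewrite lee_fin trunc_sqr_ge0.
(* Since [fine] sends infinite values to 0, finiteness comes first; the majorant provides it. *)
rewrite -lee_fin /Mfun -/(trunc_sqr (_, _)) fineK; last first.
  by rewrite ge0_fin_numE //; apply: le_lt_trans le1 _; rewrite ltry.
apply: le_trans le1 _; rewrite lee_fin; apply/eqW.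
rewrite -(pair_bigA _ (fun i j => cell_prob i * cell_prob j * h i j)) /=.
by apply: eq_bigr => i _; rewrite mulr_sumr; apply: eq_bigr => j _; rewrite mulrA.
Qed.

End TruncatedSecondMoment.

(** The function [min (u^2, 1)] is 2-Lipschitz, as it is constant once [|u| >= 1]. *)
Lemma trunc_sqr_perturb (s t r : RR) : `|s - t| <= r ->
  Num.min (s ^+ 2) 1 <= Num.min (t ^+ 2) 1 + 2 * r.
Proof.
move=> st; have r0 : 0 <= r by apply: le_trans st.
have [t1|t1] := lerP 1 `|t|.
  have tt : 1 <= t ^+ 2 by rewrite -(real_normK (num_real t)) exprn_ege1.
  rewrite [Num.min (t ^+ 2) 1]min_r //.
  by apply: (@le_trans _ _ 1); [rewrite ge_min lexx orbT | lra].
have t0 := normr_ge0 t.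
have tt : t ^+ 2 <= 1 by rewrite -(real_normK (num_real t)) expr_le1 // ltW.
rewrite [Num.min (t ^+ 2) 1]min_l //.
have sr : `|s| <= `|t| + r.
  by have := ler_normD (s - t) t; rewrite subrK; lra.
have s0 := normr_ge0 s.
rewrite ge_min; have [s1|s1] := lerP `|s| 1.
  apply/orP; left; rewrite -(real_normK (num_real s)) -(real_normK (num_real t)).
  rewrite !expr2; nra.
apply/orP; right; rewrite -(real_normK (num_real t)) expr2; nra.
Qed.

(** * Tightness and quantization of the common law *)

Lemma probability_tight (mu : probability RR RR) (e : RR) : 0 < e ->
  exists k : nat, fine (mu (~` `[- k%:R, k%:R[)) <= e.
Proof.
move=> e0; pose F (k : nat) : set RR := [set` `[- k%:R, k%:R[].
have mF k : measurable (F k) by exact: measurable_itv.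
have FT : \bigcup_k F k = setT.
  apply/seteqP; split => // x _.
  exists (Num.truncn `|x|).+1 => //; rewrite /F /= in_itv /=.
  have /andP[_ h] := truncn_itv (normr_ge0 x).
  move: h; rewrite ltr_norml => /andP[h1 h2].
  by rewrite h2 (ltW h1).
have ndF : nondecreasing_seq F.
  move=> i j ij; apply/subsetPset => x; rewrite /F /= !in_itv /= => /andP[h1 h2].
  have ijR : (i%:R : RR) <= j%:R by rewrite ler_nat.
  by apply/andP; split; [lra | apply: lt_le_trans h2 ijR].
have muF : mu (F k) @[k --> \oo] --> 1%E.
  have <- : mu (\bigcup_k F k) = 1%E by rewrite FT; exact: probability_setT.
  by apply: nondecreasing_cvg_mu => //; rewrite FT.
have /fine_cvgP[_ /cvgr_dist_le/(_ e e0)] := muF.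
move=> [k _ /(_ k (leqnn k))] /= hk; exists k.
have -> : mu (~` F k) = (1 - mu (F k))%E by exact: probability_setC.
rewrite fineB //; last exact: fin_num_measure.
by apply: le_trans hk; exact: ler_norm.
Qed.

(** Cells of length [delta] starting at [-k] cover [[-k, k)], and [x] is the left endpoint of a
    cell. [None] collects the rest, of mass at most [e] by tightness; the value of [x] there is a
    placeholder. *)
Lemma quantization (mu : probability RR RR) (delta e : RR) : 0 < delta -> 0 < e ->
  exists (m : nat) (q : RR -> option 'I_m) (x : option 'I_m -> RR),
    [/\ forall j, measurable (q @^-1` [set j]),
        forall u, q u != None -> `|u - x (q u)| <= delta &
        cell_prob mu q None <= e].
Proof.
move=> d0 e0; have [k hk] := probability_tight mu e0.
(* The successor accounts for the last, possibly partial, cell. *)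
pose m := (Num.truncn (2 * k%:R / delta)).+1.
pose v (u : RR) := (u + k%:R) / delta.
pose q (u : RR) : option 'I_m :=
  if - k%:R <= u then insub (Num.truncn (v u)) else None.
pose x (j : option 'I_m) : RR := if j is Some i then - k%:R + (i : nat)%:R * delta else 0.
have v_itv u : - k%:R <= u ->
    (Num.truncn (v u))%:R <= v u < (Num.truncn (v u)).+1%:R.
  by move=> uk; apply: truncn_itv; rewrite /v divr_ge0 ?(ltW d0) //; lra.
have someE (i : 'I_m) : q @^-1` [set Some i] =
    [set` `[- k%:R + (i : nat)%:R * delta, - k%:R + (i : nat).+1%:R * delta[].
  have vE (u : RR) (j : nat) : (j%:R <= v u < j.+1%:R) =
      (u \in `[- k%:R + j%:R * delta, - k%:R + j.+1%:R * delta[).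
    rewrite /v in_itv /= ler_pdivlMr // ltr_pdivrMr //.
    by congr (_ && _); apply/idP/idP; lra.
  apply/seteqP; split => u /=; rewrite /q.
    case: ifP => // uk; case: insubP => // j _ jE [<-].
    by rewrite -vE jE v_itv.
  rewrite -vE => /andP[h1 h2].
  have uk : - k%:R <= u.
    have : 0 <= v u by apply: le_trans h1.
    by rewrite /v ler_pdivlMr // mul0r; lra.
  rewrite uk; have -> : Num.truncn (v u) = i.
    by apply/eqP; rewrite truncn_eq ?h1 //; apply: le_trans h1.
  by rewrite valK.
have noneE : q @^-1` [set None] = ~` \bigcup_(i in [set: 'I_m]) (q @^-1` [set Some i]).
  apply/seteqP; split => u /=.
    by move=> qu [i _] /=; rewrite qu.
  by case E : (q u) => [i|//] h; exfalso; apply: h; exists i.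
have mq j : measurable (q @^-1` [set j]).
  case: j => [i|]; first by rewrite someE; exact: measurable_itv.
  rewrite noneE; apply: measurableC; apply: fin_bigcup_measurable => // i _.
  by rewrite someE; exact: measurable_itv.
exists m, q, x; split => //.
- move=> u; rewrite /q; case: ifP => // uk; case: insubP => //= i _ iE _.
  have := v_itv _ uk; rewrite -iE /v ler_pdivlMr // ltr_pdivrMr // -natr1.
  by move=> /andP[h1 h2]; rewrite ler_norml; apply/andP; split; lra.
- apply: le_trans hk; rewrite /cell_prob fine_le ?fin_num_measure //.
    by apply: measurableC; exact: measurable_itv.
  apply: le_measure; rewrite ?inE //.
    by apply: measurableC; exact: measurable_itv.
  move=> u /= qu; rewrite in_itv /= => /andP[u1 u2]; move: qu.
  rewrite /q u1; case: insubP => // /negP; case.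
  rewrite /m ltnS -(ler_nat RR).
  have /andP[h1 h2] := v_itv _ u1.
  have le2 : v u <= 2 * k%:R / delta.
    by rewrite /v ler_pM2r ?invr_gt0 //; lra.
  by rewrite ler_nat; apply: le_truncn.
Qed.

(** * Transfer from the random sum to its quantization *)

Section Sampling.
Context (dT : measure_display) (T : measurableType dT) (P : probability T RR).
Variables (n : nat) (X : 'I_n -> {RV P >-> RR}) (mu : probability RR RR).
Hypothesis indep : mutually_independent X.
Hypothesis law : forall k, has_law (X k) mu.
Variables (J : finType) (q : RR -> J).
Hypothesis mq : forall j, measurable (q @^-1` [set j]).

Definition sample (w : T) : {ffun 'I_n -> J} := [ffun k => q (X k w)].

Lemma sample_fiber f : sample @^-1` [set f] =
  \bigcap_(k in [set k | k \in [set: 'I_n]%SET]) (X k @^-1` (q @^-1` [set f k])).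
Proof.
apply/seteqP; split => w /=; first by move=> <- k _ /=; rewrite ffunE.
by move=> h; apply/ffunP => k; rewrite ffunE; apply: h; rewrite /= inE.
Qed.

Lemma measurable_sample f : measurable (sample @^-1` [set f]).
Proof.
rewrite sample_fiber; apply: fin_bigcap_measurable => // k _.
exact: measurable_funPTI.
Qed.

Lemma sample_prob f : cell_prob P sample f = wt (cell_prob mu q) f.
Proof.
rewrite /cell_prob sample_fiber indep; last by move=> k _; exact: mq.
have -> : (\prod_(k in [set: 'I_n]%SET) P (X k @^-1` (q @^-1` [set f k])) =
    (wt (cell_prob mu q) f)%:E)%E.
  rewrite /wt (big_morph EFin EFinM erefl).
  apply: eq_big => [k|k _]; first by rewrite inE.
  by rewrite -(cell_probE mu mq); exact: law.
by [].
Qed.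

Variables (d : nat) (a : 'I_n -> 'rV[RR]_d) (y : 'rV[RR]_d).

Lemma sqr_dist_SsumE w : dot (Ssum X a w - y) (Ssum X a w - y) =
  \sum_i (\sum_k X k w * a k 0 i - y 0 i) ^+ 2.
Proof.
apply: eq_bigr => i _; rewrite expr2 /Ssum !mxE summxE.
by under eq_bigr do rewrite mxE.
Qed.

Lemma ballE (w : T) : (enorm (Ssum X a w - y) <= Num.sqrt d%:R) =
  (dot (Ssum X a w - y) (Ssum X a w - y) <= d%:R).
Proof. by rewrite /enorm ler_sqrt. Qed.

Lemma measurable_ball : measurable [set w | enorm (Ssum X a w - y) <= Num.sqrt d%:R].
Proof.
pose g (w : T) : RR := \sum_i (\sum_k X k w * a k 0 i - y 0 i) ^+ 2.
have mg : measurable_fun setT g.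
  apply: measurable_sum => i; apply: measurable_funX; apply: measurable_funB => //.
  by apply: measurable_sum => k; apply: measurable_funM.
rewrite (_ : [set w | _] = g @^-1` [set` `]-oo, d%:R]]).
  by rewrite -[X in measurable X]setTI; apply: mg => //; exact: measurable_itv.
by apply/seteqP; split => w /=; rewrite ballE sqr_dist_SsumE in_itv.
Qed.

(** If no [X k] falls in the cell [j0], quantization moves each coordinate of the sum by at most 1,
    so squared distance [d] becomes at most [2 d + 2 d]. The exceptional event is handled by a union
    bound over the [n] indices. *)
Lemma ball_prob_le (x : J -> RR) (j0 : J) (delta : RR) :
  (forall u, q u != j0 -> `|u - x (q u)| <= delta) ->
  delta * (\sum_k \sum_i `|a k 0 i|) <= 1 ->
  (P [set w | (enorm (Ssum X a w - y) <= Num.sqrt d%:R)%R] <=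
   (\sum_(f | dot (lin_comb x a f - y) (lin_comb x a f - y) <= 4 * d%:R)
       wt (cell_prob mu q) f + n%:R * cell_prob mu q j0)%R%:E)%E.
Proof.
move=> xq da; set p := cell_prob mu q.
have p0 j : 0 <= p j by exact: cell_prob_ge0.
have p1 : \sum_j p j = 1 by exact: sum_cell_prob.
pose good (f : {ffun 'I_n -> J}) :=
  dot (lin_comb x a f - y) (lin_comb x a f - y) <= 4 * d%:R.
pose b (c : bool) : RR := if c then 1 else 0.
have b0 c : 0 <= b c by rewrite /b; case: c.
(* A majorant of the indicator of the event depending on the sample only: the good ball plus the
   number of exceptional indices. *)
pose h f := b (good f) + \sum_k b (f k == j0).
have h0 f : 0 <= h f by rewrite addr_ge0 // sumr_ge0.
set Ev := [set w | _].
have -> : P Ev = (\int[P]_w (\1_Ev w)%:E)%E.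
  by rewrite integral_indic ?setIT //; exact: measurable_ball.
apply: (@le_trans _ _ (\int[P]_w (h (sample w))%:E)%E).
  apply: ge0_le_integral => //.
  - by apply/measurable_EFinP; apply: measurable_indic; exact: measurable_ball.
  - exact: (measurable_step measurable_sample).
  move=> w _; rewrite lee_fin indicE; case: (boolP (w \in Ev)) => [|_]; last exact: h0.
  rewrite inE /Ev /= ballE => wE; rewrite /h.
  have [/existsP[k kj]|/existsPn nbad] := boolP [exists k, sample w k == j0].
    apply: (@le_trans _ _ (\sum_k b (sample w k == j0))); last by rewrite lerDr.
    have -> : (1 : RR) = b (sample w k == j0) by rewrite kj.
    exact: (@ler_sum_term RR _ (fun k => b (sample w k == j0)) k).
  suff gw : good (sample w).
    by rewrite gw -[leLHS]addr0 lerD // sumr_ge0.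
  rewrite /good.
  pose v : 'rV[RR]_d := Ssum X a w - lin_comb x a (sample w).
  have v1 i : `|v 0 i| <= 1.
    apply: le_trans da; rewrite /v /Ssum /lin_comb -sumrB summxE mulr_sumr.
    apply: le_trans (ler_norm_sum _ _ _) _; apply: ler_sum => k _.
    rewrite !mxE -mulrBl normrM.
    apply: (@le_trans _ _ (delta * `|a k 0 i|)).
      rewrite ler_wpM2r //; have := nbad k; rewrite ffunE; exact: xq.
    rewrite ler_wpM2l //; last exact: (@ler_sum_term RR _ (fun i => `|a k 0 i|) i).
    (* Nonnegativity of [delta] is read off from the bound at a non-exceptional index. *)
    by have := nbad k; rewrite ffunE => /xq; apply: le_trans.
  apply: (@le_trans _ _ (2 * dot (Ssum X a w - y) (Ssum X a w - y) + 2 * d%:R)).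
    rewrite /dot -[in d%:R](card_ord d) -sumr_const !mulr_sumr -big_split /=.
    apply: ler_sum => i _; have := v1 i.
    have -> : (lin_comb x a (sample w) - y) 0 i = (Ssum X a w - y) 0 i - v 0 i.
      by rewrite /v !mxE; ring.
    rewrite ler_norml => /andP[vi1 vi2]; set s := (Ssum X a w - y) 0 i.
    have := sqr_ge0 (s + v 0 i); rewrite expr2; nra.
  by move: wE; lra.
rewrite integral_step //; last exact: measurable_sample.
rewrite lee_fin.
under eq_bigr do rewrite sample_prob /h mulrDr mulr_sumr.
rewrite big_split /=; apply: lerD.
  rewrite [leRHS]big_mkcond /=; apply: ler_sum => f _.
  by rewrite /b /good -/p; case: ifP => _; rewrite ?mulr1 ?mulr0.
rewrite exchange_big /= -[in n%:R](card_ord n) mulr_natl -sumr_const.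
apply: ler_sum => k _; apply/eqW.
(* The marginal of coordinate [k]: the sum factors over [l], and every factor with [l != k] is the
   total mass 1. *)
pose c (l : 'I_n) (j : J) := p j * (if l == k then b (j == j0) else 1).
transitivity (\prod_l \sum_j c l j).
  rewrite bigA_distr_bigA; apply: eq_bigr => f _.
  rewrite /c big_split /= -/(wt p f); congr (_ * _).
  rewrite (bigD1 k) //= eqxx big1 ?mulr1 // => l /negbTE ->.
  by [].
rewrite (bigD1 k) //= [X in _ * X]big1 ?mulr1; last first.
  by move=> l lk; rewrite -[RHS]p1; apply: eq_bigr => j _; rewrite /c (negbTE lk) mulr1.
rewrite (bigD1 j0) //= big1 ?addr0 /c ?eqxx ?mulr1 //.
by move=> j /negbTE jj; rewrite jj mulr0.
Qed.

End Sampling.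

(** * From finite laws to the general bound *)

Lemma combine_bounds (R : realType) (K T1 T1' E E' ne : R) d : (0 < d)%N ->
  1 <= K -> 0 <= T1 -> 0 <= E -> T1' <= 2 ^+ d * T1 -> E' <= E -> ne <= T1 ->
  K ^+ d * (T1' + E') + ne <= (2 * (2 * K)) ^+ d * (T1 + E).
Proof.
move=> d0 K1 T0 E0 hT hE hne.
have K0 : 0 <= K by lra.
have Kd : 1 <= K ^+ d by rewrite exprn_ege1.
have two1 : 1 <= (2 : R) by rewrite ler1n.
(* With [d > 0] a second factor [2 ^+ d] is at least 2 and absorbs the additive error [ne]. *)
have D2 : 2 <= (2 : R) ^+ d by case: d d0 {hT Kd} => // d _; rewrite exprS ler_peMr // exprn_ege1.
rewrite !exprMn; set D := 2 ^+ d in hT D2 *; set k := K ^+ d in Kd *.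
have h1 : T1' + E' <= D * (T1 + E) by nra.
have h2 : k * (T1' + E') <= k * (D * (T1 + E)) by rewrite ler_wpM2l //; lra.
have h3 : T1 <= k * (D * (T1 + E)).
  have : T1 <= D * (T1 + E) by nra.
  have : 0 <= D * (T1 + E) by nra.
  by move=> ? ?; nra.
have h4 : 0 <= k * (D * (T1 + E)) by lra.
have -> : D * (D * k) * (T1 + E) = D * (k * (D * (T1 + E))) by ring.
nra.
Qed.

Lemma Mfun_ge0 (mu : probability RR RR) : 0 <= Mfun mu 1.
Proof.
rewrite /Mfun fine_ge0 //; apply: integral_ge0 => x _; apply: integral_ge0 => y _.
by rewrite lee_fin (trunc_sqr_ge0 (x, y)).
Qed.

(** Outside [j0] a difference moves by at most [2 * delta], which costs [4 * delta] since the
    truncated square is 2-Lipschitz. A pair touching [j0] costs at most 1, and each of its two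
    entries does so with probability [cell_prob mu q j0]. *)
Lemma Mfun_quantized (mu : probability RR RR) (J : finType) (q : RR -> J)
    (x : J -> RR) (j0 : J) (delta : RR) :
  (forall j, measurable (q @^-1` [set j])) -> 0 <= delta ->
  (forall u, q u != j0 -> `|u - x (q u)| <= delta) ->
  Mfun mu 1 <= \sum_(ij : J * J) cell_prob mu q ij.1 * cell_prob mu q ij.2 *
      Num.min ((x ij.1 - x ij.2) ^+ 2) 1
    + (4 * delta + 2 * cell_prob mu q j0).
Proof.
move=> mq d0 xq; set p := cell_prob mu q.
have p0 j : 0 <= p j by exact: cell_prob_ge0.
have p1 : \sum_j p j = 1 by exact: sum_cell_prob.
pose b (c : bool) : RR := if c then 1 else 0.
have b0 c : 0 <= b c by rewrite /b; case: c.
have m0 (r : RR) : 0 <= Num.min (r ^+ 2) 1 by rewrite le_min sqr_ge0 ler01.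
pose h (i j : J) : RR := Num.min ((x i - x j) ^+ 2) 1 + (4 * delta + (b (i == j0) + b (j == j0))).
have h0 i j : 0 <= h i j.
  by have := m0 (x i - x j); have := b0 (i == j0); have := b0 (j == j0); rewrite /h; lra.
have gh u v : trunc_sqr (u, v) <= h (q u) (q v).
  rewrite /trunc_sqr /= expr1n divr1 /h.
  have m1 : Num.min ((u - v) ^+ 2) 1 <= 1 :> RR by rewrite ge_min lexx orbT.
  have := m0 (x (q u) - x (q v)).
  have := b0 (q u == j0); have := b0 (q v == j0).
  case: (eqVneq (q u) j0) => [_|/xq qu].
    by rewrite [b true](_ : _ = 1) //; lra.
  case: (eqVneq (q v) j0) => [_|/xq qv].
    by rewrite [b true](_ : _ = 1) //; lra.
  rewrite [b false](_ : _ = 0) // => _ _ _.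
  have := @trunc_sqr_perturb (u - v) (x (q u) - x (q v)) (2 * delta).
  have -> : u - v - (x (q u) - x (q v)) = (u - x (q u)) - (v - x (q v)) by ring.
  have := ler_normB (u - x (q u)) (v - x (q v)) => h1 h2.
  have {}h2 := h2 (ltac:(lra)); lra.
apply: le_trans (@Mfun_le mu J q mq h h0 gh) _; apply/eqW.
have pb : \sum_j p j * b (j == j0) = p j0.
  rewrite (bigD1 j0) //= big1 ?addr0 ?eqxx ?mulr1 //.
  by move=> j /negbTE jj; rewrite jj mulr0.
have sumE (g : J -> J -> RR) : \sum_(ij : J * J) p ij.1 * p ij.2 * g ij.1 ij.2 =
    \sum_i p i * \sum_j p j * g i j.
  rewrite -(pair_bigA _ (fun i j => p i * p j * g i j)) /=.
  by apply: eq_bigr => i _; rewrite mulr_sumr; apply: eq_bigr => j _; rewrite mulrA.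
rewrite -/p (sumE h) (sumE (fun i j => Num.min ((x i - x j) ^+ 2) 1)).
have pc c : \sum_j p j * c = c by rewrite -mulr_suml p1 mul1r.
have inner i : \sum_j p j * h i j =
    \sum_j p j * Num.min ((x i - x j) ^+ 2) 1 + (4 * delta + (b (i == j0) + p j0)).
  transitivity (\sum_j (p j * Num.min ((x i - x j) ^+ 2) 1 +
      (p j * (4 * delta) + (p j * b (i == j0) + p j * b (j == j0))))).
    by apply: eq_bigr => j _; rewrite /h; ring.
  by rewrite !big_split /= !pc pb.
under eq_bigr do rewrite inner mulrDr.
rewrite big_split /=; congr (_ + _).
transitivity (\sum_i (p i * (4 * delta) + (p i * b (i == j0) + p i * p j0))).
  by apply: eq_bigr => i _; ring.
by rewrite !big_split /= !pc pb; ring.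
Qed.

Theorem theorem1 :
  exists (C c : RR), 1 <= C /\ 0 < c /\
  forall (d n : nat), (0 < d)%N -> (0 < n)%N ->
  forall (d0 : measure_display) (T : measurableType d0) (P : probability T RR)
         (mu : probability RR RR) (X : 'I_n -> {RV P >-> RR})
         (a : 'I_n -> 'rV[RR]_d) (alpha : RR),
    mutually_independent X ->
    (forall k, has_law (X k) mu) ->
    0 < alpha ->
    (forall (m : 'I_n -> int) (t : 'rV[RR]_d),
        (exists k, 1 / 2 <= `| dotv t (a k) |) ->
        enorm t <= Num.sqrt (d%:R) ->
        alpha ^+ 2 <= \sum_(k < n) (dotv t (a k) - (m k)%:~R) ^+ 2) ->
    (concQ P (Ssum X a) (Num.sqrt d%:R) <=
      (if ((\det (Nmat a) == 0) || (Mfun mu 1 == 0))%R then +oo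
       else (C ^+ d * ((1 / Num.sqrt (Mfun mu 1)) ^+ d / Num.sqrt (\det (Nmat a))
                       + expR (- (c * alpha ^+ 2 * Mfun mu 1))))%R%:E))%E.
Proof.
pose K : RR := 2 ^+ 11 * (2 ^+ 8 * 2 ^+ 4).
have K1 : 1 <= K by rewrite !mulr_ege1 ?exprn_ege1 ?ler1n.
(* The finite bound has rate [1/2] in a quantized moment [M' >= M / 2], whence [1/4]; the factor 4
   is spent in [combine_bounds]. *)
exists (2 * (2 * K)), (1 / 4); split; first by clearbody K; lra.
split; first lra.
move=> d n dpos _ dT T P mu X a alpha indep law _ hyp.
case: ifPn => [_|]; first exact: leey.
rewrite negb_or => /andP[dN M0].
set M := Mfun mu 1 in M0 *.
have Mpos : 0 < M by rewrite lt_neqAle eq_sym M0 Mfun_ge0.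
rewrite -[Nmat a]/(gram a) in dN *.
have inc : incoherent a alpha.
  move=> m t big t1; apply: hyp big _.
  rewrite /enorm ler_wsqrtr // /dotv -[in d%:R](card_ord d) -sumr_const.
  apply: ler_sum => i _; have := t1 i; rewrite ler_norml => /andP[? ?]; nra.
set T1 := _ / Num.sqrt (\det _).
have T1pos : 0 < T1.
  by rewrite divr_gt0 ?sqrtr_gt0 ?det_gram_gt0 // exprn_gt0 // divr_gt0 // sqrtr_gt0.
pose A : RR := \sum_k \sum_i `|a k 0 i|.
have A0 : 0 <= A by apply: sumr_ge0 => k _; apply: sumr_ge0.
(* The first entry limits the moment loss [4 * delta] to [M / 4]; the second keeps the displacement
   of the sum below 1, with [A + 1] covering [A = 0]. *)
pose delta := Num.min (M / 16) (1 / (A + 1)).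
have delta0 : 0 < delta by rewrite lt_min !divr_gt0 //; lra.
have delta1 : delta <= M / 16 by rewrite ge_min lexx.
have deltaA : delta * A <= 1.
  have : delta <= 1 / (A + 1) by rewrite ge_min lexx orbT.
  rewrite ler_pdivlMr; last by lra.
  nra.
(* The first entry limits the loss [2 * e] to [M / 4], so that [M' >= M / 2]; the second keeps the
   union bound [n * e] below [T1]. *)
pose e := Num.min (M / 8) (T1 / (n%:R + 1)).
have n0 : 0 <= (n%:R : RR) by rewrite ler0n.
have n1 : 0 < (n%:R + 1 : RR) by rewrite ltr_wpDl.
have e0 : 0 < e.
  by rewrite lt_min; apply/andP; split; [lra | exact: divr_gt0].
have e1 : e <= M / 8 by rewrite ge_min lexx.
have en : n%:R * e <= T1.
  have : e <= T1 / (n%:R + 1) by rewrite ge_min lexx orbT.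
  rewrite ler_pdivlMr // mulrDr mulr1 (mulrC e); apply: le_trans.
  by rewrite lerDl ltW.
have [m [q [x [mq xq pe]]]] := quantization mu delta0 e0.
pose p := cell_prob mu q; rewrite -/p in pe.
pose M' := \sum_ij p ij.1 * p ij.2 * Num.min ((x ij.1 - x ij.2) ^+ 2) 1.
have MM' : M <= 2 * M'.
  have := Mfun_quantized mu mq (ltW delta0) xq; rewrite -/p -/M -/M'; lra.
have M'pos : 0 < M' by lra.
apply: ub_ereal_sup => _ [y _ <-].
apply: le_trans (ball_prob_le indep law mq y xq deltaA) _.
rewrite lee_fin.
have p0 j : 0 <= p j by exact: cell_prob_ge0.
have p1 : \sum_j p j = 1 by exact: sum_cell_prob.
have main := concentration_finite y erefl p0 p1 M'pos dN inc.
apply: le_trans (lerD main (ler_wpM2l n0 pe)) _.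
have hT : (1 / Num.sqrt M') ^+ d / Num.sqrt (\det (gram a)) <= 2 ^+ d * T1.
  rewrite /T1 mulrA ler_wpM2r ?invr_ge0 ?sqrtr_ge0 //.
  exact: inv_sqrt_pow_le.
have hE : expR (- (1 / 2 * alpha ^+ 2 * M')) <= expR (- (1 / 4 * alpha ^+ 2 * M)).
  by rewrite ler_expR lerN2; have := sqr_ge0 alpha; nra.
exact: (combine_bounds dpos K1 (ltW T1pos) (expR_ge0 _) hT hE en).
Qed.
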